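(* Let $P\subset N_{\mathbb{Q}}$ be a Kähler–Einstein Fano triangle. Then $P$ is minimal.
   Context: Let $N\cong\mathbb{Z}^2$, $M=\mathrm{Hom}(N,\mathbb{Z})$, $N_{\mathbb{Q}}=N\otimes\mathbb{Q}$, $M_{\mathbb{Q}}=M\otimes\mathbb{Q}$. A convex lattice polygon $P\subset N_{\mathbb{Q}}$ is Fano if the origin lies in its strict interior and every vertex $(x,y)$ satisfies $\gcd(x,y)=1$. The dual of $P$ is $P^*=\{u\in M_{\mathbb{Q}} : u(x)\ge -1\ \forall x\in P\}$; a Fano polygon is Kähler–Einstein if the barycentre (centroid) of $P^*$ is the origin. Mutation: let $P$ be a Fano polygon and $w\in M$ primitive. Put $h_{\min}=\min_{x\in P}w(x)$, $h_{\max}=\max_{x\in P}w(x)$. For an integer $h$ let $N_h=\{x\in N: w(x)=h\}$, $P_h=\mathrm{conv}(P\cap N_h)$, and let $\mathcal{V}(P)_h$ be the set of vertices of $P$ lying in $N_h$. A lattice polytope $F\subset N_{\mathbb{Q}}$ is a factor of $P$ with respect to $w$ if $w(F)=\{0\}$ and for every integer $h$ with $h_{\min}\le h<0$ there is a (possibly empty) lattice polytope $R_h\subset N_{\mathbb{Q}}$ with $\mathcal{V}(P)_h\subseteq R_h+|h|F\subseteq P_h$. The mutation of $P$ with respect to $w$ and $F$ is $\mathrm{mut}_w(P,F)=\mathrm{conv}\big(\bigcup_{h=h_{\min}}^{-1}R_h\cup\bigcup_{h=0}^{h_{\max}}(P_h+hF)\big)$ (it does not depend on the choice of the $R_h$).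 A Fano polygon $P$ is minimal if $|\partial P\cap N|\le|\partial Q\cap N|$ for every mutation $Q=\mathrm{mut}_w(P,F)$ of $P$. *)

(* Defs.v *)
From HB Require Import structures.
From mathcomp Require Import all_boot all_order all_algebra.
From mathcomp Require Import all_classical all_reals all_analysis.

Set Implicit Arguments.
Unset Strict Implicit.
Unset Printing Implicit Defensive.

Import Order.TTheory GRing.Theory Num.Theory.
Import numFieldNormedType.Exports.

Local Open Scope classical_set_scope.
Local Open Scope ring_scope.

(* A basis of N is fixed: N = 'rV[int]_2 and N_Q = 'rV[rat]_2.  Elements of M
   and of M_K = M (x) K are pairs of coordinates in the dual basis; pairs rather
   than vectors because the library's plane Lebesgue measure lives on R * R. *)

(* rat^o rather than rat: only the former carries the usual topology of Q. *)
Notation NQ := 'rV[rat^o]_2.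

Definition lattice_pt (v : 'rV[int]_2) : NQ :=
  map_mx (fun n : int => n%:~R) v.

Definition pairing (K : pzRingType) (u : K * K) (x : 'rV[K]_2) : K :=
  u.1 * x 0 0 + u.2 * x 0 1.

Definition weval (w : int * int) (x : NQ) : rat :=
  pairing (w.1%:~R, w.2%:~R) x.

Definition primitive (w : int * int) : Prop := coprimez w.1 w.2.

Definition conv_hull (A : set NQ) : set NQ :=
  smallest (@convex_set rat NQ) A.

(* The empty set is a lattice polytope. *)
Definition lattice_polytope (P : set NQ) : Prop :=
  exists s : seq 'rV[int]_2, P = conv_hull [set lattice_pt v | v in [set` s]].

Definition vertices (P : set NQ) : set NQ :=
  [set x | P x /\ forall (y z : NQ) (t : rat), P y -> P z ->
     0 < t -> t < 1 -> x = t *: y + (1 - t) *: z -> y = x /\ z = x].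

Definition fano (P : set NQ) : Prop :=
  [/\ lattice_polytope P,
      P° 0
    & forall v : 'rV[int]_2, vertices P (lattice_pt v) ->
        coprimez (v 0 0) (v 0 1)].

Definition triangle (P : set NQ) : Prop := (vertices P #= `I_3)%card.

(* For K = rat this is the dual polygon in M_Q; for K = R it is the real polygon
   that it spans, over which one integrates to obtain its barycentre. *)
Definition dual (K : numFieldType) (P : set NQ) : set (K * K) :=
  [set u | forall x, P x -> -1 <= pairing u (map_mx ratr x)].
Arguments dual K P : clear implicits.

Section Barycentre.
Variable R : realType.

Definition area : {measure set (measurableTypeR R * measurableTypeR R) -> \bar R} :=
  (@lebesgue_measure R \x @lebesgue_measure R)%E.

Definition barycentre (A : set (R * R)) : R * R :=
  ((\int[area]_(u in A) u.1) / fine (area A),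
   (\int[area]_(u in A) u.2) / fine (area A)).

Definition kahler_einstein (P : set NQ) : Prop :=
  fano P /\ barycentre (dual R P) = (0, 0).

End Barycentre.

Definition minkowski_sum (A B : set NQ) : set NQ :=
  [set x + y | x in A & y in B].

Definition dilate (n : int) (A : set NQ) : set NQ :=
  [set n%:~R *: x | x in A].

Section Mutation.
Variables (w : int * int) (P F : set NQ).

(* The minimum and maximum of w on a lattice polytope are attained at lattice
   points, hence are integers; 0 is a dummy value when they do not exist. *)
Definition hmin : int :=
  xget 0 [set h : int | (weval w @` P) h%:~R /\ lbound (weval w @` P) h%:~R].

Definition hmax : int :=
  xget 0 [set h : int | (weval w @` P) h%:~R /\ ubound (weval w @` P) h%:~R].

(* N_h, as a subset of N_Q. *)
Definition level (h : int) : set NQ :=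
  [set lattice_pt v | v in [set v | weval w (lattice_pt v) = h%:~R]].

(* P_h; for rational h_min < h < h_max this may be smaller than the full slice
   of P at height h. *)
Definition slice (h : int) : set NQ := conv_hull (P `&` level h).

Definition remainders (Rh : int -> set NQ) : Prop :=
  forall h : int, hmin <= h -> h < 0 ->
    [/\ lattice_polytope (Rh h),
        vertices P `&` level h `<=` minkowski_sum (Rh h) (dilate `|h| F)
      & minkowski_sum (Rh h) (dilate `|h| F) `<=` slice h].

Definition factor : Prop :=
  [/\ lattice_polytope F,
      weval w @` F = [set 0]
    & exists Rh, remainders Rh].

Definition mut (Rh : int -> set NQ) : set NQ :=
  conv_hull
    ((\bigcup_(h in [set h : int | hmin <= h <= -1]) Rh h) `|`
     (\bigcup_(h in [set h : int | 0 <= h <= hmax])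
        minkowski_sum (slice h) (dilate h F))).

(* Q = mut_w(P, F); it does not depend on the choice of the remainders. *)
Definition is_mutation (Q : set NQ) : Prop :=
  factor /\ exists2 Rh, remainders Rh & Q = mut Rh.

End Mutation.

Definition boundary_lattice_pts (P : set NQ) : set 'rV[int]_2 :=
  [set v | (closure P `\` P°) (lattice_pt v)].

(* Cardinals are compared with #<=, which agrees with <= on the sizes of finite
   sets and needs no default value. *)
Definition minimal (P : set NQ) : Prop :=
  fano P /\
  forall (w : int * int) (F Q : set NQ), primitive w ->
    is_mutation w P F Q ->
    (boundary_lattice_pts P #<= boundary_lattice_pts Q)%card.

(* Main.v *)
From HB Require Import structures.
Require Import Defs.
From mathcomp Require Import finmap.
From mathcomp Require Import all_boot all_order all_algebra.
From mathcomp Require Import all_classical all_reals all_analysis.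
From mathcomp Require Import measurable_realfun zify ring lra.

Set Implicit Arguments.
Unset Strict Implicit.
Unset Printing Implicit Defensive.

Import Order.TTheory GRing.Theory Num.Theory.
Import numFieldNormedType.Exports.

Local Open Scope classical_set_scope.
Local Open Scope ring_scope.

(** The proof has two independent halves.

    The barycentre of a triangle is the mean of its vertices, and for the dual
    of a triangle with vertices [a], [b], [c] this says that it is the origin
    only if [a + b + c = 0].  Let [l], [m], [n] be the positive weights of sum 1
    with [l a + m b + n c = 0].  On the dual triangle [T] the functions
    [l (1 + <a, u>)], [m (1 + <b, u>)], [n (1 + <c, u>)] are the barycentric
    coordinates of [u].  The part of [T] on which one of them is at least
    [1 - t] is the image of [T] under the homothety of ratio [t] about a vertex,
    so it has area [t ^ 2 area T]; integrating over the levels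
    ([layer_cake], [cone_integral]), all three coordinates have the same mean on
    [T].  If the barycentre of [T] is 0 these means are [l], [m], [n], because
    the linear parts integrate to 0.  Hence the weights are equal
    ([equal_weights], [kahler_einstein_triangle]).

    For the second half let [a + b + c = 0], and let [F] be the factor, a
    segment from [al e] to [be e] where [e] spans the lattice points of
    height 0.  A linear form bounded below on [P] gives one on the mutation,
    tilted by its minimum on [F] ([mut_pairing]); the vertices of [P] move
    accordingly ([mut_vertex]).
    If [al = be], the mutation is the image of [P] under a shear of the lattice
    ([translate_mutation]).
    If [al < be], the face of [P] at the lowest height must contain a translate
    of a positive multiple of [F], hence it is an edge, say [[a, b]] at height
    [- h], and as the heights add up to 0 the vertex [c] has height [2 h].
    The mutation replaces the bottom edge by one that is shorter by
    [h (be - al)] in lattice length and the vertex [c] by an edge of lattice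
    length [2 h (be - al)], while the two other edges are sheared.  So the
    boundary gains [h (be - al)] lattice points.  Rather than counting, an
    injection from the boundary points of [P] to those of the mutation is given
    ([wide_mutation]): shear the two sloping edges and the part of the bottom
    edge that fits, and send the rest of the bottom edge to the new top edge. *)

(** * Convex hulls and vertices *)

Section Hull.
Implicit Types (A B C : set NQ) (x y z : NQ) (t : rat).

Lemma convex_setP (A : set NQ) : @convex_set rat NQ A <->
  (forall x y t, A x -> A y -> 0 <= t -> t <= 1 -> A (t *: x + (1 - t) *: y)).
Proof.
split=> [cA x y t Ax Ay t0 t1|cA x y l].
  by have := cA x y (Itv01 t0 t1); rewrite !inE; apply.
by rewrite !inE => Ax Ay; apply: cA.
Qed.

Lemma sub_conv_hull A : A `<=` conv_hull A.
Proof. exact: sub_gen_smallest. Qed.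

Lemma conv_hull_convex A x y t : conv_hull A x -> conv_hull A y ->
  0 <= t -> t <= 1 -> conv_hull A (t *: x + (1 - t) *: y).
Proof.
move=> Ax Ay t0 t1 C CA; have [/convex_setP cC _] := CA.
by apply: cC => //; [exact: Ax|exact: Ay].
Qed.

Lemma conv_hull_min A C :
  (forall x y t, C x -> C y -> 0 <= t -> t <= 1 -> C (t *: x + (1 - t) *: y)) ->
  A `<=` C -> conv_hull A `<=` C.
Proof. by move=> cC AC; apply: smallest_sub => //; exact/convex_setP. Qed.

Lemma conv_hullS A B : A `<=` conv_hull B -> conv_hull A `<=` conv_hull B.
Proof. by apply: conv_hull_min => *; exact: conv_hull_convex. Qed.

Lemma conv_hull0 : conv_hull set0 = set0.
Proof. by apply/seteqP; split=> //; apply: conv_hull_min. Qed.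

(** The hull of [x |` A] is the cone from [x] over the hull of [A].  For [t = 1]
    the point [z] is arbitrary, which covers an empty [A]. *)
Lemma conv_hullU1 x A y : conv_hull (x |` A) y ->
  exists t z, [/\ 0 <= t <= 1, t < 1 -> conv_hull A z & y = t *: x + (1 - t) *: z].
Proof.
move: y; apply: conv_hull_min; last first.
  move=> y [->|Ay]; last first.
    exists 0, y; split; rewrite ?lexx ?ler01//; first by move=> _; exact: sub_conv_hull.
    by rewrite scale0r subr0 scale1r add0r.
  exists 1, 0; split; rewrite ?ltxx// ?lexx ?ler01//.
  by rewrite scale1r scaler0 addr0.
move=> _ _ s [t1 [z1 [/andP[t10 t11] z1A ->]]] [t2 [z2 [/andP[t20 t21] z2A ->]]] s0 s1.
pose a := s * (1 - t1); pose b := (1 - s) * (1 - t2).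
have a0 : 0 <= a by apply: mulr_ge0 => //; rewrite subr_ge0.
have b0 : 0 <= b by apply: mulr_ge0; rewrite subr_ge0.
have ab1 : a + b <= 1 by rewrite /a /b; nra.
have [ab0|abn0] := eqVneq (a + b) 0.
  have a_eq0 : a = 0 by lra.
  have b_eq0 : b = 0 by lra.
  exists 1, 0; split; rewrite ?ltxx// ?lexx ?ler01//.
  rewrite scale1r scaler0 addr0 !scalerDr !scalerA -/a -/b a_eq0 b_eq0.
  rewrite !scale0r !addr0 -scalerDl -[RHS]scale1r; congr (_ *: _).
  by move: a_eq0 b_eq0; rewrite /a /b; lra.
have ab_gt0 : 0 < a + b by rewrite lt_neqAle eq_sym abn0 addr_ge0.
(* [a] and [b] are the weights of [z1] and [z2] in the combination. *)
exists (1 - (a + b)), ((a / (a + b)) *: z1 + (1 - a / (a + b)) *: z2); split.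
- by rewrite subr_ge0 ab1 gerBl ltW.
- move=> _.
  have [a_eq0|an0] := eqVneq a 0.
    rewrite a_eq0 mul0r scale0r add0r subr0 scale1r; apply: z2A.
    rewrite lt_neqAle t21 andbT; apply: contraNneq abn0 => t2_eq.
    by rewrite a_eq0 /b t2_eq subrr mulr0 addr0.
  have [b_eq0|bn0] := eqVneq b 0.
    rewrite b_eq0 addr0 divff// subrr scale0r addr0 scale1r; apply: z1A.
    rewrite lt_neqAle t11 andbT; apply: contraNneq an0 => t1_eq.
    by rewrite /a t1_eq subrr mulr0.
  apply: conv_hull_convex.
  + apply: z1A; rewrite lt_neqAle t11 andbT; apply: contraNneq an0 => t1_eq.
    by rewrite /a t1_eq subrr mulr0.
  + apply: z2A; rewrite lt_neqAle t21 andbT; apply: contraNneq bn0 => t2_eq.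
    by rewrite /b t2_eq subrr mulr0.
  + by rewrite divr_ge0// ltW.
  + by rewrite ler_pdivrMr// mul1r lerDl.
- rewrite opprB addrCA subrr addr0 !scalerDr !scalerA -/a -/b.
  rewrite [(a + b) * _]mulrC divfK// mulrBr mulr1 [(a + b) * _]mulrC divfK//.
  rewrite [a + b - a]addrAC subrr add0r addrACA -scalerDl; congr (_ *: _ + _).
  by rewrite /a /b; ring.
Qed.

Definition lattice_seq (s : seq 'rV[int]_2) : set NQ :=
  [set lattice_pt v | v in [set` s]].

Lemma lattice_seq_cons v s : lattice_seq (v :: s) = lattice_pt v |` lattice_seq s.
Proof.
apply/seteqP; split=> x /=.
  case=> u /=; rewrite inE => /orP[/eqP -> <-|us <-]; [by left|by right; exists u].
case=> [->|[u us <-]]; first by exists v => //=; rewrite inE eqxx.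
by exists u => //=; rewrite inE us orbT.
Qed.

Lemma lattice_pt_inj : injective lattice_pt.
Proof.
move=> u v /matrixP uv; apply/matrixP => i j.
by have := uv i j; rewrite !mxE; exact: intr_inj.
Qed.

Lemma extreme_mem (P : set NQ) (s : seq 'rV[int]_2) x :
  conv_hull (lattice_seq s) `<=` P -> vertices P x ->
  conv_hull (lattice_seq s) x -> lattice_seq s x.
Proof.
move=> + [Px ext]; elim: s => [_|v s IHs sP].
  by rewrite (_ : lattice_seq [::] = set0) ?conv_hull0//; apply/seteqP; split=> ? // [].
rewrite lattice_seq_cons => /conv_hullU1[t [z [/andP[t0 t1] zs xE]]].
have sub : conv_hull (lattice_seq s) `<=` P.
  apply: subset_trans sP; rewrite lattice_seq_cons; apply: conv_hullS.
  by move=> u us; apply: sub_conv_hull; right.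
have Pv : P (lattice_pt v).
  by apply: sP; apply: sub_conv_hull; rewrite lattice_seq_cons; left.
have [t_eq1|tn1] := eqVneq t 1.
  by left; rewrite xE t_eq1 subrr scale0r addr0 scale1r.
have lt_t1 : t < 1 by rewrite lt_neqAle tn1.
have [t_eq0|tn0] := eqVneq t 0.
  right; apply: IHs => //; rewrite xE t_eq0 scale0r add0r subr0 scale1r.
  exact: zs.
left; have [] // := ext _ _ t Pv (sub _ (zs lt_t1)) _ lt_t1 xE.
by rewrite lt_neqAle eq_sym tn0.
Qed.

(** If a segment through [v] left [v], then solving for [v] in it would express
    [v] by the other generators alone. *)
Lemma vertex_or_redundant v s :
  vertices (conv_hull (lattice_seq (v :: s))) (lattice_pt v) \/
  conv_hull (lattice_seq s) (lattice_pt v).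
Proof.
have [|nv] := pselect (conv_hull (lattice_seq s) (lattice_pt v)); first by right.
left; rewrite lattice_seq_cons; split; first by apply: sub_conv_hull; left.
set x := lattice_pt v in nv *.
move=> y z t /conv_hullU1[a [y' [/andP[a0 a1] y's ->]]].
move=> /conv_hullU1[b [z' [/andP[b0 b1] z's ->]]] t0 t1 xE.
pose p := t * (1 - a); pose q := (1 - t) * (1 - b).
have p0 : 0 <= p by rewrite mulr_ge0 ?subr_ge0// ltW.
have q0 : 0 <= q by rewrite mulr_ge0 ?subr_ge0// ltW.
have xE2 : x = (t * a + (1 - t) * b) *: x + (p *: y' + q *: z').
  by rewrite [LHS]xE !scalerDr !scalerA -/p -/q scalerDl addrACA.
have pqE : (p + q) *: x = p *: y' + q *: z'.
  have -> : p + q = 1 - (t * a + (1 - t) * b) by rewrite /p /q; ring.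
  by rewrite scalerBl scale1r {1}xE2 addrC addKr.
have [pq0|pqn0] := eqVneq (p + q) 0.
  have /eqP : p = 0 by lra.
  have /eqP : q = 0 by lra.
  rewrite !mulf_eq0 subr_eq0 (gt_eqF t1) (gt_eqF t0) /= !subr_eq0.
  by move=> /eqP <- /eqP <-; rewrite subrr scale0r addr0 scale1r scale0r addr0.
have pq_gt0 : 0 < p + q by rewrite lt_neqAle eq_sym pqn0 addr_ge0.
have xE' : x = (p / (p + q)) *: y' + (1 - p / (p + q)) *: z'.
  have -> : 1 - p / (p + q) = q / (p + q) by field.
  apply: (scalerI pqn0); rewrite pqE scalerDr !scalerA.
  by rewrite ![(p + q) * _]mulrC !divfK.
exfalso; apply: nv; rewrite xE'.
have [p_eq0|pn0] := eqVneq p 0.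
  rewrite p_eq0 mul0r scale0r add0r subr0 scale1r; apply: z's.
  rewrite lt_neqAle b1 andbT; apply: contraNneq pqn0 => b_eq.
  by rewrite p_eq0 /q b_eq subrr mulr0 addr0.
have [q_eq0|qn0] := eqVneq q 0.
  rewrite q_eq0 addr0 divff// subrr scale0r addr0 scale1r; apply: y's.
  rewrite lt_neqAle a1 andbT; apply: contraNneq pn0 => a_eq.
  by rewrite /p a_eq subrr mulr0.
apply: conv_hull_convex.
- apply: y's; rewrite lt_neqAle a1 andbT; apply: contraNneq pn0 => a_eq.
  by rewrite /p a_eq subrr mulr0.
- apply: z's; rewrite lt_neqAle b1 andbT; apply: contraNneq qn0 => b_eq.
  by rewrite /q b_eq subrr mulr0.
- by rewrite divr_ge0// ltW.
- by rewrite ler_pdivrMr// mul1r lerDl.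
Qed.

(** Generators that are not extreme can be dropped one by one, and the extreme
    points are always among the generators. *)
Lemma hull_of_vertices (P : set NQ) : lattice_polytope P ->
  exists s : seq 'rV[int]_2,
    [/\ uniq s, P = conv_hull (lattice_seq s) & vertices P = lattice_seq s].
Proof.
case=> s; have [n] := ubnP (size s); elim: n s => // n IHn s /ltnSE sn PE.
have [allv|] := pselect (forall v, v \in s -> vertices P (lattice_pt v)).
  have sE : lattice_seq (undup s) = lattice_seq s.
    by apply/seteqP; split=> x [v vs <-]; exists v => //=; move: vs => /=;
      rewrite mem_undup.
  exists (undup s); rewrite sE; split=> //; first exact: undup_uniq.
  apply/seteqP; split=> x; last by case=> v /allv ? <-.
  move=> vx; apply: (extreme_mem (P := P)) => //; first by rewrite PE.
  by rewrite -[conv_hull _]PE; case: vx.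
move=> /existsNP[v /not_implyP[vs nv]].
have sE : lattice_seq s = lattice_pt v |` lattice_seq (rem v s).
  rewrite -lattice_seq_cons; apply/seteqP.
  by split=> x [u us <-]; exists u => //=; move: us => /=;
    rewrite (perm_mem (perm_to_rem vs)).
apply: (IHn (rem v s)).
  by move: sn; rewrite (perm_size (perm_to_rem vs)).
rewrite PE -/(lattice_seq s) sE; apply/seteqP; split; apply: conv_hullS.
  move=> x [->|]; last exact: sub_conv_hull.
  have [vP|//] := vertex_or_redundant v (rem v s).
  by case: nv; rewrite PE -/(lattice_seq s) sE -lattice_seq_cons.
by move=> x xs; apply: sub_conv_hull; right.
Qed.

End Hull.

Lemma row2_eq (T : Type) (x y : 'rV[T]_2) :
  x 0 0 = y 0 0 -> x 0 1 = y 0 1 -> x = y.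
Proof.
move=> e0 e1; apply/matrixP => i j; rewrite (ord1 i).
by case: j => -[|[|//]] h; [move: e0|move: e1]; congr (x _ _ = y _ _); apply: val_inj.
Qed.

Lemma three_elements (s : seq 'rV[int]_2) : uniq s ->
  (lattice_seq s #= `I_3)%card -> size s = 3%N.
Proof.
move=> us cs; rewrite -(undup_id us) -card_fseq.
have : ([set` s] #= `I_3)%card.
  apply: card_eq_trans cs; rewrite card_eq_sym; apply: inj_card_eq.
  by move=> x y _ _; exact: lattice_pt_inj.
move=> /card_fset_set <-; congr (#|` _|).
apply/fsetP => x; rewrite in_fset_set; last exact: finite_seq.
by rewrite finmap.inE; apply/idP/idP => [xs|/set_mem//]; exact/mem_set.
Qed.

(** * Linear forms and neighbourhoods of the origin *)

Lemma interior_square (A : set NQ) (x : NQ) : A° x -> exists2 eps : rat, 0 < eps &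
  forall y : NQ, `|y 0 0 - x 0 0| <= eps -> `|y 0 1 - x 0 1| <= eps -> A y.
Proof.
rewrite /interior => /nbhs_ballP[/= eps eps0 sub].
exists (eps / 2); first lra.
move=> y y0 y1; apply: sub; split=> // i j.
rewrite /ball /= (ord1 i) distrC; apply: le_lt_trans (_ : eps / 2 < eps); last lra.
by case: j => -[|[|//]] /= h; [move: y0|move: y1];
  congr (`|y _ _ - x _ _| <= _); apply: val_inj.
Qed.

Lemma pairingD (u : rat * rat) (x y : NQ) : pairing u (x + y) = pairing u x + pairing u y.
Proof. by rewrite /pairing !mxE; ring. Qed.

Lemma pairingZ (u : rat * rat) (t : rat) (x : NQ) : pairing u (t *: x) = t * pairing u x.
Proof. by rewrite /pairing !mxE; ring. Qed.

Lemma conv_hull_pairing (u : rat * rat) (k : rat) (A : set NQ) :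
  (forall x, A x -> k <= pairing u x) -> forall x, conv_hull A x -> k <= pairing u x.
Proof.
move=> Ak; apply: conv_hull_min Ak => x y t kx ky t0 t1.
by rewrite pairingD !pairingZ; nra.
Qed.

(** A hull around the origin meets every open half-plane whose boundary passes
    through 0, so already its generators do. *)
Lemma pairing_lt0 (A : set NQ) (u : rat * rat) : (conv_hull A)° 0 -> u != (0, 0) ->
  exists2 x, A x & pairing u x < 0.
Proof.
move=> /interior_square[eps eps0 sub] un0.
apply: contrapT => noneg.
have Au x : A x -> 0 <= pairing u x.
  by move=> Ax; rewrite leNgt; apply/negP => ux; apply: noneg; exists x.
pose n := `|u.1| + `|u.2|.
have n0 : 0 < n.
  rewrite lt_neqAle addr_ge0// andbT eq_sym; apply: contraNneq un0.
  by rewrite /n => /eqP; rewrite paddr_eq0// !normr_eq0 => /andP[/eqP u1 /eqP u2];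
    case: u u1 u2 {Au noneg n} => x y /= -> ->.
pose x : NQ := \row_j (- (eps / n) * (if j == 0 then u.1 else u.2)).
have : conv_hull A x.
  have en : 0 < eps / n by apply: divr_gt0.
  have le1 : `|u.1| <= n by rewrite lerDl.
  have le2 : `|u.2| <= n by rewrite lerDr.
  have h v : `|v| <= n -> `|- (eps / n) * v| <= eps.
    move=> vn; rewrite normrM normrN (gtr0_norm en) mulrAC ler_pdivrMr//.
    by rewrite ler_pM2l.
  by apply: sub; rewrite !mxE /= subr0; exact: h.
move=> /(conv_hull_pairing Au).
rewrite /pairing !mxE /= leNgt => /negP; apply.
have -> : u.1 * (- (eps / n) * u.1) + u.2 * (- (eps / n) * u.2) =
  - ((eps / n) * (u.1 ^+ 2 + u.2 ^+ 2)) by ring.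
rewrite oppr_lt0 mulr_gt0 ?divr_gt0// lt_neqAle addr_ge0 ?sqr_ge0// andbT eq_sym.
rewrite paddr_eq0 ?sqr_ge0// !sqrf_eq0; apply: contraNN un0.
by case: u {Au noneg n n0 x} => x y /= /andP[/eqP -> /eqP ->].
Qed.

Definition cross (x y : NQ) : rat := x 0 0 * y 0 1 - x 0 1 * y 0 0.

(** Otherwise [x] and [z] would lie in one closed half-plane bounded by the line
    through [y] and 0. *)
Lemma cross_same_sign (x y z : NQ) : (conv_hull [set x; y; z])° 0 -> y != 0 ->
  0 < cross x y * cross y z.
Proof.
move=> P0 yn0.
have [|a Aa a0] := @pairing_lt0 _ (- y 0 1, y 0 0) P0.
  apply: contraNN yn0 => /eqP [/eqP y1 y0]; move: y1; rewrite oppr_eq0 => /eqP y1.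
  by apply/eqP/row2_eq; rewrite mxE.
have [|b Ab b0] := @pairing_lt0 _ (y 0 1, - y 0 0) P0.
  apply: contraNN yn0 => /eqP [y1 /eqP y0]; move: y0; rewrite oppr_eq0 => /eqP y0.
  by apply/eqP/row2_eq; rewrite mxE.
(* The two forms are [cross y] and its opposite; both vanish at [y]. *)
have neg : cross x y > 0 \/ cross y z < 0.
  case: Aa a0 => [[]|] ->; rewrite /pairing /cross /=; [left|lra|right]; lra.
have pos : cross x y < 0 \/ cross y z > 0.
  case: Ab b0 => [[]|] ->; rewrite /pairing /cross /=; [left|lra|right]; lra.
by case: neg pos => ? [] ?; try lra; nra.
Qed.

(** * The barycentre of a triangle *)

Section Area.
Variable R : realType.
Local Notation mR := (measurableTypeR R).

Lemma measurable_affine1 (c d : R) :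
  measurable_fun [set: mR] (fun x : mR => c * x + d : mR).
Proof. by apply: measurable_funD => //; exact: mulrl_measurable. Qed.

(** Both sides, seen as measures, agree on half-open intervals. *)
Lemma lebesgue_affine (c d : R) (A : set mR) : 0 < c -> measurable A ->
  lebesgue_measure ((fun x : mR => c * x + d : mR) @^-1` A) =
  ((c^-1)%:E * lebesgue_measure A)%E.
Proof.
move=> c0 mA.
pose f : mR -> mR := fun x => c * x + d.
have mf : measurable_fun setT f by exact: measurable_affine1.
pose nu : {measure set mR -> \bar R} :=
  mscale (NngNum (ltW c0)) (pushforward (@lebesgue_measure R) f).
have nuE B : nu mf B = (c%:E * lebesgue_measure (f @^-1` B))%E by [].
have -> : lebesgue_measure A = nu mf A.
  apply: lebesgue_measure_unique => // _ [[a b] _ <-].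
  rewrite nuE.
  have -> : f @^-1` `]a, b]%classic = `](a - d) / c, (b - d) / c]%classic.
    apply/seteqP; split=> x /=; rewrite !in_itv /= /f ltr_pdivrMr// ler_pdivlMr//;
      rewrite ltrBlDr lerBrDr [x * c]mulrC//.
  rewrite !lebesgue_measure_itv /= !lte_fin ltr_pM2r ?invr_gt0// ltrD2r.
  case: ifP => _; rewrite ?mule0//.
  congr EFin; rewrite -!mulrBl opprD addrACA subrr addr0; field; lra.
rewrite nuE muleA -EFinM mulVf ?mul1e// gt_eqF//.
Qed.

Lemma area_rectangle (A B : set mR) : measurable A -> measurable B ->
  area R (A `*` B) = (lebesgue_measure A * lebesgue_measure B)%E.
Proof. by move=> mA mB; exact: product_measure1E. Qed.

(** Both sides, seen as measures, agree on rectangles. *)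
Lemma area_homothety (c d1 d2 : R) (X : set (mR * mR)) : 0 < c -> measurable X ->
  area R ((fun u : mR * mR => (c * u.1 + d1, c * u.2 + d2) : mR * mR) @^-1` X) =
  ((c^-1 ^+ 2)%:E * area R X)%E.
Proof.
move=> c0 mX.
pose f := fun u : mR * mR => (c * u.1 + d1, c * u.2 + d2) : mR * mR.
have mf : measurable_fun setT f.
  by apply/measurable_fun_pair; [apply: (measurableT_comp (measurable_affine1 c d1)) |
    apply: (measurableT_comp (measurable_affine1 c d2))].
have c20 : 0 <= c ^+ 2 by rewrite exprn_ge0// ltW.
have key (x y : \bar R) :
    ((c ^+ 2)%:E * ((c^-1)%:E * x * ((c^-1)%:E * y)) = x * y)%E.
  rewrite muleACA [LHS]muleA -[((c^-1)%:E * _)%E]EFinM -[((c ^+ 2)%:E * _)%E]EFinM.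
  by rewrite [X in X%:E](_ : _ = 1) ?mul1e//; field; lra.
pose nu : {measure set (mR * mR) -> \bar R} :=
  mscale (NngNum c20) (pushforward (area R) f).
have nuE B : nu mf B = ((c ^+ 2)%:E * area R (f @^-1` B))%E by [].
have -> : area R X = nu mf X.
  apply: product_measure_unique => // A B mA mB.
  rewrite nuE.
  have -> : f @^-1` (A `*` B) = ((fun x : mR => c * x + d1 : mR) @^-1` A) `*`
                          ((fun x : mR => c * x + d2 : mR) @^-1` B) by [].
  rewrite area_rectangle.
  - rewrite !lebesgue_affine//; exact: key.
  - by rewrite -[X in measurable X]setTI; exact: measurable_affine1.
  - by rewrite -[X in measurable X]setTI; exact: measurable_affine1.
rewrite nuE muleA -EFinM.
by rewrite [X in (X%:E * _)%E](_ : _ = 1) ?mul1e//; field; lra.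
Qed.

End Area.

Section LayerCake.
Context d (T : measurableType d) (R : realType).
Variable mu : {measure set T -> \bar R}.

(** Tonelli for the region below the graph of [f]. *)
Lemma layer_cake (D : set T) (f : T -> R) :
  sigma_finite setT mu ->
  measurable D -> measurable_fun setT f -> (forall x, D x -> 0 <= f x) ->
  (\int[mu]_(x in D) (f x)%:E =
   \int[lebesgue_measure]_(t in `[0%R, +oo[) mu (D `&` [set x | t < f x]%R))%E.
Proof.
move=> sf mD mf f0.
(* [smu] is [mu] together with its sigma-finiteness. *)
pose H2 := isSFinite.Build _ _ _ _ (sfinite_measure_sigma_finite sf).
pose H3 := isSigmaFinite.Build _ _ _ _ sf.
pose smu := HB.pack_for (SigmaFiniteMeasure.type T R) (Measure.sort mu) H2 H3.
pose mR := measurableTypeR R.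
pose E : set (T * mR) := (fst @^-1` D) `&` [set p | 0 <= p.2] `&` [set p | p.2 < f p.1].
have mE : measurable E.
  apply: measurableI; first apply: measurableI.
  - by rewrite -[X in measurable X]setTI; exact: measurable_fst.
  - have m : measurable_fun setT (fun p : T * mR => 0 <= p.2).
      exact: measurable_fun_ler.
    by have := m measurableT [set true] I; rewrite setTI.
  - have m : measurable_fun setT (fun p : T * mR => p.2 < f p.1).
      apply: measurable_fun_ltr => //.
      exact: (measurableT_comp mf (@measurable_fst _ _ T mR)).
    by have := m measurableT [set true] I; rewrite setTI.
have := indic_fubini_tonelli smu (@lebesgue_measure R) mE.
rewrite indic_fubini_tonelli_FE// indic_fubini_tonelli_GE// => eqI.
transitivity (\int[mu]_x ((@lebesgue_measure R \o xsection E) x))%E.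
  rewrite integral_mkcond; apply: eq_integral => x _ /=.
  rewrite patchE; case: ifPn => [/set_mem Dx|/negP nDx].
    have -> : xsection E x = `[0, f x[%classic.
      apply/seteqP; split=> t; rewrite /xsection /= in_itv /= inE /E /=.
        by case=> [[]] _ -> ->.
      by case/andP.
    rewrite lebesgue_measure_itv /= lte_fin.
    case: ltP => [_|]; first by rewrite sube0.
    by move=> fx; congr EFin; apply/eqP; rewrite eq_le fx f0.
  have -> : xsection E x = set0.
    apply/seteqP; split=> t //; rewrite /xsection /= inE /E /= => -[[Dx]].
    by case: nDx; rewrite inE.
  by rewrite measure0.
rewrite eqI [RHS]integral_mkcond; apply: eq_integral => t _ /=.
rewrite patchE; case: ifPn => [|/negP nt].
  rewrite inE /= in_itv /= andbT => t0; congr (mu _).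
  apply/seteqP; split=> x; rewrite /ysection /= inE /E /=; first by case=> [[]].
  by case.
have -> : ysection E t = set0.
  apply/seteqP; split=> x //; rewrite /ysection /= inE /E /= => -[[_ t0]].
  by case: nt; rewrite inE /= in_itv /= t0.
by rewrite measure0.
Qed.
End LayerCake.

Section Cone.
Variable R : realType.
Local Notation mR := (measurableTypeR R).

Lemma point_rectangle (e : mR * mR) : [set e] = [set e.1] `*` [set e.2].
Proof. by apply/seteqP; split=> -[x y] /= => [<-|[-> ->]]//; case: e. Qed.

Lemma measurable_point (e : mR * mR) : measurable [set e].
Proof. by rewrite point_rectangle; exact: measurableX. Qed.

Lemma area_point (e : mR * mR) : area R [set e] = 0%E.
Proof.
by rewrite point_rectangle area_rectangle// lebesgue_measure_set1 mul0e.
Qed.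

Lemma sigma_finite_area : sigma_finite setT (area R).
Proof.
have /sigma_finiteP[F [TF ndF Foo]] := sigma_finiteT (@lebesgue_measure R).
exists (fun n => F n `*` F n).
  apply/seteqP; split=> // -[x y] _.
  have [n _ Fx] : (\bigcup_i F i) x by rewrite -TF.
  have [m _ Fy] : (\bigcup_i F i) y by rewrite -TF.
  exists (maxn n m) => //; split => /=.
  - by move: x Fx; exact/subsetPset/ndF/leq_maxl.
  - by move: y Fy; exact/subsetPset/ndF/leq_maxr.
move=> k; have [mFk Fk] := Foo k; split; first exact: measurableX.
by rewrite area_rectangle// lte_mul_pinfty// ge0_fin_numE.
Qed.

(** The model is a cone [T] with apex [e], and [b] the affine function that is 0
    on its base and 1 at [e].  The hypothesis on [t] says that the homothety of
    ratio [t] about [e] maps [T] onto the part of [T] above the level [1 - t].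
    The right-hand side depends on [T] only through its area. *)
Lemma cone_integral (T : set (mR * mR)) (e : mR * mR) (b : mR * mR -> R) :
  measurable T -> (area R T < +oo)%E -> measurable_fun setT b ->
  (forall u, T u -> 0 <= b u <= 1) ->
  (forall u, T u -> 1 <= b u -> u = e) ->
  (forall t u, 0 < t <= 1 -> (T u /\ 1 - t <= b u) <->
    T (t^-1 * u.1 + (e.1 - t^-1 * e.1), t^-1 * u.2 + (e.2 - t^-1 * e.2))) ->
  (\int[area R]_(u in T) (1 - b u)%:E =
   \int[lebesgue_measure]_(t in `[0%R, +oo[)
      ((Num.max 0 (1 - t ^+ 2))%:E * area R T))%E.
Proof.
move=> mT Tfin mb b01 b1 hT.
have mc : measurable_fun setT (fun u => 1 - b u) by exact: measurable_funB.
have c0 u : T u -> 0 <= 1 - b u by move=> /b01 /andP[_]; rewrite subr_ge0.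
transitivity (\int[@lebesgue_measure R]_(t in `[0%R, +oo[) area R (T `&` [set x | t < 1 - b x]%R))%E.
  exact: layer_cake sigma_finite_area mT mc c0.
apply: eq_integral => t /set_mem t_itv.
have t0 : 0 <= t by move: t_itv; rewrite /= in_itv /= andbT.
have fT : area R T = (fine (area R T))%:E by rewrite fineK// ge0_fin_numE.
pose S := [set u | 1 - t <= b u].
have mS : measurable (T `&` S).
  apply: measurableI => //.
  have m : measurable_fun setT (fun u : mR * mR => 1 - t <= b u).
    exact: measurable_fun_ler.
  by have := m measurableT [set true] I; rewrite setTI.
have -> : T `&` [set x | t < 1 - b x] = T `\` (T `&` S).
  apply/seteqP; split=> u /= [Tu tu]; split=> //.
    by case=> _; rewrite /S /= leNgt ltrBrDr addrC -ltrBrDr tu.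
  rewrite ltNge; apply/negP => btu; apply: tu; split=> //.
  by rewrite /S /=; lra.
have -> : area R (T `\` (T `&` S)) = (area R T - area R (T `&` S))%E.
  by rewrite measureD// setIA setIid.
have [t1|t1] := leP t 1; last first.
  have -> : T `&` S = T.
    apply/setIidPl => u Tu; rewrite /S /=; have := b01 _ Tu; lra.
  have -> : Num.max 0 (1 - t ^+ 2) = 0 :> R by apply/max_idPl; nra.
  by rewrite mul0e fT -EFinB subrr.
have -> : Num.max 0 (1 - t ^+ 2) = 1 - t ^+ 2 :> R by apply/max_idPr; nra.
have -> : area R (T `&` S) = ((t ^+ 2)%:E * area R T)%E; last first.
  move: (fine (area R T)) fT => a ->.
  by rewrite -!EFinM -EFinB mulrBl mul1r.
(* The homothety of ratio 0 is not invertible; here the part is one point. *)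
have [t_eq0|t_neq0] := eqVneq t 0.
  rewrite t_eq0 expr0n /= mul0e; apply/eqP; rewrite eq_le measure_ge0 andbT.
  rewrite -(area_point e); apply: le_measure; [exact/mem_set | apply/mem_set; exact: measurable_point |].
  by move=> u [Tu bu]; apply: b1 Tu _; rewrite -[1]subr0 -t_eq0.
have t_gt0 : 0 < t by rewrite lt_neqAle eq_sym t_neq0.
rewrite -[t in RHS]invrK -(area_homothety (e.1 - t^-1 * e.1) (e.2 - t^-1 * e.2))//;
  last by rewrite invr_gt0.
congr (area R _); apply/seteqP; split=> u.
  by move/(hT t u (introT andP (conj t_gt0 t1))).
by move/(hT t u (introT andP (conj t_gt0 t1))).
Qed.
End Cone.

Section Centroid.
Variable R : realType.
Local Notation mR := (measurableTypeR R).

Definition slack (p u : R * R) : R := 1 + (p.1 * u.1 + p.2 * u.2).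

Definition halfplanes (p q r : R * R) : set (mR * mR) :=
  [set u | [/\ 0 <= slack p u, 0 <= slack q u & 0 <= slack r u]].

Lemma measurable_slack (p : R * R) :
  measurable_fun setT (fun u : mR * mR => slack p u).
Proof.
by apply: measurable_funD => //; apply: measurable_funD; exact: measurable_funM.
Qed.

Lemma measurable_halfplanes p q r : measurable (halfplanes p q r).
Proof.
have m (x : R * R) : measurable [set u : mR * mR | 0 <= slack x u].
  have mx : measurable_fun setT (fun u : mR * mR => 0 <= slack x u).
    by apply: measurable_fun_ler => //; exact: measurable_slack.
  by have := mx measurableT [set true] I; rewrite setTI.
rewrite (_ : halfplanes p q r = [set u | 0 <= slack p u] `&`
  ([set u | 0 <= slack q u] `&` [set u | 0 <= slack r u])).
  by do 2?apply: measurableI.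
by apply/seteqP; split=> u; [case|case=> ? []].
Qed.

Definition tail_integral : \bar R :=
  (\int[lebesgue_measure]_(t in `[0%R, +oo[) (Num.max 0 (1 - t ^+ 2))%:E)%E.

(** [l * slack p] is the barycentric coordinate of the triangle at the vertex
    where the slacks of [q] and [r] vanish. *)
Lemma barycentric_integral (p q r : R * R) (l m n : R) :
  0 < l -> 0 < m -> 0 < n -> l + m + n = 1 ->
  l * p.1 + m * q.1 + n * r.1 = 0 -> l * p.2 + m * q.2 + n * r.2 = 0 ->
  q.1 * r.2 - q.2 * r.1 != 0 ->
  (area R (halfplanes p q r) < +oo)%E ->
  (\int[area R]_(u in halfplanes p q r) (1 - l * slack p u)%:E =
   tail_integral * area R (halfplanes p q r))%E.
Proof.
move=> l0 m0 n0 lmn eq1 eq2 d0 Tfin.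
set T := halfplanes p q r; set d := _ - _ in d0.
have sum1 u : l * slack p u + m * slack q u + n * slack r u = 1.
  transitivity ((l + m + n) + ((l * p.1 + m * q.1 + n * r.1) * u.1 +
    (l * p.2 + m * q.2 + n * r.2) * u.2)); first by rewrite /slack; ring.
  by rewrite lmn eq1 eq2; ring.
(* The common zero of the slacks of [q] and [r], by Cramer's rule. *)
pose e : mR * mR := ((q.2 - r.2) / d, (r.1 - q.1) / d).
have qe : slack q e = 0 by rewrite /slack /e /d /=; field; exact: d0.
have re : slack r e = 0 by rewrite /slack /e /d /=; field; exact: d0.
have pe : l * slack p e = 1 by rewrite -(sum1 e) qe re; ring.
rewrite (@cone_integral R T e (fun u => l * slack p u)) //.
- rewrite ge0_integralZr//=.
  + apply/measurable_EFinP; apply: measurable_funTS.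
    by apply: measurable_maxr => //; exact: measurable_funB.
  + by move=> t _; rewrite lee_fin le_max lexx.
- exact: measurable_halfplanes.
- by apply: measurable_funM => //; exact: measurable_slack.
- move=> u [pu qu ru]; have := sum1 u.
  by rewrite mulr_ge0 ?(ltW l0)//=; nra.
- move=> u [pu qu ru] l1; have := sum1 u => su.
  have q0 : slack q u = 0 by nra.
  have r0 : slack r u = 0 by nra.
  case: u q0 r0 {pu qu ru l1 su} => x y; rewrite /slack /= => q0 r0.
  rewrite /e; congr (_, _); apply: (mulIf d0); rewrite divfK// /d.
    have -> : x * (q.1 * r.2 - q.2 * r.1) = (q.1 * x + q.2 * y) * r.2 - (r.1 * x + r.2 * y) * q.2 by ring.
    by move: q0 r0 => /eqP; rewrite addrC addr_eq0 => /eqP -> /eqP; rewrite addrC addr_eq0 => /eqP ->; ring.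
  have -> : y * (q.1 * r.2 - q.2 * r.1) = (r.1 * x + r.2 * y) * q.1 - (q.1 * x + q.2 * y) * r.1 by ring.
  by move: q0 r0 => /eqP; rewrite addrC addr_eq0 => /eqP -> /eqP; rewrite addrC addr_eq0 => /eqP ->; ring.
- clearbody e; move=> t u /andP[t0 t1].
  set g := (X in _ <-> T X).
  have tn0 : t != 0 by rewrite gt_eqF.
  have sg s : slack s g = t^-1 * (slack s u - (1 - t) * slack s e).
    by rewrite /slack /g /=; field.
  have ti : 0 < t^-1 by rewrite invr_gt0.
  have qg : (0 <= slack q g) = (0 <= slack q u).
    by rewrite sg qe mulr0 subr0 pmulr_rge0.
  have rg : (0 <= slack r g) = (0 <= slack r u).
    by rewrite sg re mulr0 subr0 pmulr_rge0.
  have pg : (0 <= slack p g) = (1 - t <= l * slack p u).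
    rewrite sg pmulr_rge0// -(pmulr_rge0 _ l0) mulrBr mulrCA pe mulr1.
    by rewrite subr_ge0.
  split.
    by case=> -[pu qu ru] tu; split; rewrite ?qg ?rg ?pg.
  case; rewrite qg rg pg => pu qu ru; split=> //; split=> //.
  by rewrite -(pmulr_rge0 _ l0); apply: le_trans pu; rewrite subr_ge0.
Qed.

End Centroid.

Section Weights.
Variable R : realType.
Local Notation mR := (measurableTypeR R).

Definition box (r : R) : set (mR * mR) := `[-r, r]%classic `*` `[-r, r]%classic.

Lemma area_box (r : R) : 0 < r -> area R (box r) = ((r + r) ^+ 2)%:E.
Proof.
move=> r0; rewrite area_rectangle// lebesgue_measure_itv /= lte_fin.
by rewrite ifT; [rewrite -EFinM opprK expr2|lra].
Qed.

Lemma le_box_area (T : set (mR * mR)) (r s : R) : measurable T -> 0 < r -> 0 < s ->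
  box r `<=` T -> T `<=` box s -> exists2 a, 0 < a & area R T = a%:E.
Proof.
move=> mT r0 s0 rT Ts.
have mb x : measurable (box x) by exact: measurableX.
have h1 : (((r + r) ^+ 2)%:E <= area R T)%E.
  by rewrite -area_box//; apply: le_measure => //; exact/mem_set.
have h2 : (area R T <= ((s + s) ^+ 2)%:E)%E.
  by rewrite -area_box//; apply: le_measure => //; exact/mem_set.
case: (area R T) h1 h2 => [a| |] //; rewrite !lee_fin => h1 _.
by exists a => //; apply: lt_le_trans h1; nra.
Qed.

(** The linear part of [slack p] integrates to 0, so the mean of [l * slack p]
    is [l]; by slicing, this mean is the same for all three coordinates. *)
Lemma barycentric_weight (p q r : R * R) (l m n : R) (a b : R) :
  0 < l -> 0 < m -> 0 < n -> l + m + n = 1 ->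
  l * p.1 + m * q.1 + n * r.1 = 0 -> l * p.2 + m * q.2 + n * r.2 = 0 ->
  q.1 * r.2 - q.2 * r.1 != 0 ->
  let T := halfplanes p q r in
  0 < a -> area R T = a%:E ->
  T `<=` box b ->
  \int[area R]_(u in T) u.1 = 0 -> \int[area R]_(u in T) u.2 = 0 ->
  (1 - l)%:E = tail_integral R.
Proof.
move=> l0 m0 n0 lmn eq1 eq2 d0 T a0 aT Tb I1 I2.
have Tfin : (area R T < +oo)%E by rewrite aT ltry.
have mT : measurable T by exact: measurable_halfplanes.
have := barycentric_integral l0 m0 n0 lmn eq1 eq2 d0 Tfin.
have int1 : (area R).-integrable T (EFin \o (fun u : mR * mR => u.1 : R)).
  apply: measurable_bounded_integrable => //; first by apply: measurable_funTS; exact: measurable_fst.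
  exists b; split; first exact: num_real.
  move=> y /ltW yb u /Tb [/= + _]; rewrite in_itv /= => ub.
  by apply: le_trans yb; rewrite ler_norml.
have int2 : (area R).-integrable T (EFin \o (fun u : mR * mR => u.2 : R)).
  apply: measurable_bounded_integrable => //; first by apply: measurable_funTS; exact: measurable_snd.
  exists b; split; first exact: num_real.
  move=> y /ltW yb u /Tb [/= _]; rewrite in_itv /= => ub.
  by apply: le_trans yb; rewrite ler_norml.
have intc (k : R) : (area R).-integrable T (EFin \o cst k).
  apply: measurable_bounded_integrable => //.
  exists `|k|; split; first exact: num_real.
  by move=> y /ltW yb u _; exact: yb.
have int1' : (area R).-integrable T (EFin \o (fun u : mR * mR => l * p.1 * u.1)).
  exact: integrableZl int1.
have int2' : (area R).-integrable T (EFin \o (fun u : mR * mR => l * p.2 * u.2)).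
  exact: integrableZl int2.
have int3 : (area R).-integrable T
    (EFin \o (fun u : mR * mR => l * p.1 * u.1 + l * p.2 * u.2)).
  exact: integrableD int1' int2'.
have int4 : (area R).-integrable T
    (EFin \o (fun u : mR * mR => (1 - l) - (l * p.1 * u.1 + l * p.2 * u.2))).
  exact: integrableB (intc (1 - l)) int3.
have -> : (\int[area R]_(u in T) (1 - l * slack p u)%:E =
    (\int[area R]_(u in T) ((1 - l) - (l * p.1 * u.1 + l * p.2 * u.2)))%:E)%E.
  rewrite /Rintegral fineK; last exact: (integrable_fin_num _ int4).
  by apply: eq_integral => u _; congr EFin; rewrite /slack; ring.
rewrite RintegralB//; last exact: intc.
rewrite Rintegral_cst// RintegralD// !RintegralZl// I1 I2 aT /=.
rewrite !mulr0 addr0 subr0.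
case: (tail_integral R) => [t| |].
- by move=> [] /(mulIf (lt0r_neq0 a0)) ->.
- by rewrite mulyr gtr0_sg// mul1e.
- by rewrite mulNyr gtr0_sg// mul1e.
Qed.

Lemma equal_weights (p q r : R * R) (l m n : R) (a b : R) :
  0 < l -> 0 < m -> 0 < n -> l + m + n = 1 ->
  l * p.1 + m * q.1 + n * r.1 = 0 -> l * p.2 + m * q.2 + n * r.2 = 0 ->
  p.1 * q.2 - p.2 * q.1 != 0 ->
  q.1 * r.2 - q.2 * r.1 != 0 ->
  r.1 * p.2 - r.2 * p.1 != 0 ->
  let T := halfplanes p q r in
  0 < a -> 0 < b -> box a `<=` T -> T `<=` box b ->
  barycentre T = (0, 0) ->
  l = m /\ m = n.
Proof.
move=> l0 m0 n0 lmn eq1 eq2 dpq dqr drp T a0 b0 aT Tb [].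
have [A A0 AT] := le_box_area (measurable_halfplanes p q r) a0 b0 aT Tb.
rewrite AT /=.
move=> /eqP; rewrite mulf_eq0 invr_eq0 (gt_eqF A0) orbF => /eqP I1.
move=> /eqP; rewrite mulf_eq0 invr_eq0 (gt_eqF A0) orbF => /eqP I2.
have T2 : halfplanes q r p = T by apply/seteqP; split=> u [].
have T3 : halfplanes r p q = T by apply/seteqP; split=> u [].
have w1 := barycentric_weight l0 m0 n0 lmn eq1 eq2 dqr A0 AT Tb I1 I2.
have w2 : (1 - m)%:E = tail_integral R.
  apply: (@barycentric_weight q r p m n l A b); rewrite ?T2//.
  - by rewrite -lmn; ring.
  - by rewrite -eq1; ring.
  - by rewrite -eq2; ring.
have w3 : (1 - n)%:E = tail_integral R.
  apply: (@barycentric_weight r p q n l m A b); rewrite ?T3//.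
  - by rewrite -lmn; ring.
  - by rewrite -eq1; ring.
  - by rewrite -eq2; ring.
have := etrans w1 (esym w2); have := etrans w2 (esym w3).
by move=> [] e1 [] e2; split; lra.
Qed.
End Weights.

(** * Kähler-Einstein triangles have centroid 0 *)

Lemma lattice_seq3 (a b c : 'rV[int]_2) :
  lattice_seq [:: a; b; c] = [set lattice_pt a; lattice_pt b; lattice_pt c].
Proof.
rewrite !lattice_seq_cons (_ : lattice_seq [::] = set0) ?setU0 ?setUA//.
by apply/seteqP; split=> // x [].
Qed.

Section RealPoints.
Variable R : realType.

Definition real_pt (x : NQ) : R * R := (ratr (x 0 0), ratr (x 0 1)).

Lemma dual_conv_hull3 (x y z : NQ) :
  dual R (conv_hull [set x; y; z]) = halfplanes (real_pt x) (real_pt y) (real_pt z).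
Proof.
have sE (u : R * R) w : (0 <= slack (real_pt w) u) = (-1 <= pairing u (map_mx ratr w)).
  by rewrite /slack /pairing !mxE /= -[-1 <= _]subr_ge0 opprK addrC
    [u.1 * _]mulrC [u.2 * _]mulrC.
apply/seteqP; split=> u /=.
  by move=> uP; split; rewrite sE; apply: uP; apply: sub_conv_hull;
    [left; left|left; right|right].
case; rewrite !sE => ux uy uz w.
move: w; apply: conv_hull_min => [a b t|]; last by move=> w [[]|] ->.
rewrite /pairing !mxE !rmorphD !rmorphM /= rmorphB rmorph1 => ha hb t0 t1.
have t0' : 0 <= ratr t :> R by rewrite ler0q.
have t1' : ratr t <= 1 :> R by rewrite -(rmorph1 (@ratr R)) ler_rat.
nra.
Qed.

(** [P] contains a positive and a negative multiple of each basis vector. *)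
Lemma dual_in_box (P : set NQ) : P° 0 -> exists2 b : R, 0 < b & dual R P `<=` box b.
Proof.
move=> /interior_square[eps eps0 sub].
have e0 : 0 < ratr eps :> R by rewrite ltr0q.
exists (ratr eps)^-1; first by rewrite invr_gt0.
move=> u uP.
have inP (s t : rat) : `|s| <= eps -> `|t| <= eps ->
    -1 <= u.1 * ratr s + u.2 * ratr t.
  move=> hs ht; have := uP (\row_j (if j == 0 then s else t)).
  by rewrite /pairing !mxE /=; apply; apply: sub; rewrite !mxE /= subr0.
have n0 : `|0 : rat| <= eps by rewrite normr0 ltW.
have np : `|eps| <= eps by rewrite gtr0_norm.
have nn : `|- eps| <= eps by rewrite normrN gtr0_norm.
have b1 := inP _ _ np n0; have b2 := inP _ _ nn n0.
have b3 := inP _ _ n0 np; have b4 := inP _ _ n0 nn.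
move: b1 b2 b3 b4; rewrite rmorphN rmorph0 !mulr0 !mulrN !addr0 !add0r => b1 b2 b3 b4.
split; rewrite /= in_itv /=; apply/andP; split.
- by rewrite lerNl -[leRHS]mul1r ler_pdivlMr//; lra.
- by rewrite -[leRHS]mul1r ler_pdivlMr//; lra.
- by rewrite lerNl -[leRHS]mul1r ler_pdivlMr//; lra.
- by rewrite -[leRHS]mul1r ler_pdivlMr//; lra.
Qed.

Lemma box_in_halfplanes (p q r : R * R) : exists2 a, 0 < a & box a `<=` halfplanes p q r.
Proof.
pose n (x : R * R) := `|x.1| + `|x.2|.
have n_ge0 x : 0 <= n x by rewrite addr_ge0.
pose N := 1 + (n p + n q + n r).
have N0 : 0 < N by have := n_ge0 p; have := n_ge0 q; have := n_ge0 r; rewrite /N; lra.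
exists N^-1; first by rewrite invr_gt0.
move=> u [/=]; rewrite !in_itv /= -!ler_norml => u1 u2.
have h x : n x <= N -> 0 <= slack x u.
  move=> xN; rewrite /slack.
  suff : `|x.1 * u.1 + x.2 * u.2| <= 1 by rewrite ler_norml => /andP[]; lra.
  apply: le_trans (ler_normD _ _) _; rewrite !normrM.
  apply: le_trans (_ : n x * N^-1 <= _); last by rewrite ler_pdivrMr// mul1r.
  by rewrite mulrDl lerD// ler_wpM2l.
by have := n_ge0 p; have := n_ge0 q; have := n_ge0 r; split; apply: h; rewrite /N; lra.
Qed.

End RealPoints.

Definition centred_triangle (P : set NQ) (a b c : 'rV[int]_2) : Prop :=
  [/\ P = conv_hull [set lattice_pt a; lattice_pt b; lattice_pt c],
      lattice_pt a + lattice_pt b + lattice_pt c = 0,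
      cross (lattice_pt a) (lattice_pt b) != 0
    & vertices P = [set lattice_pt a; lattice_pt b; lattice_pt c]].

Lemma coprime_neq0 (v : 'rV[int]_2) : coprimez (v 0 0) (v 0 1) -> lattice_pt v != 0.
Proof.
apply: contraTneq => /matrixP v0.
have h i : v 0 i = 0.
  by apply/eqP; rewrite -(intr_eq0 rat); have := v0 0 i; rewrite !mxE => ->.
by rewrite !h.
Qed.

(** With [dx x + dy y + dz z = 0] for the cross products of the vertices [x],
    [y], [z], the weights are [dx], [dy], [dz] divided by their sum; they are
    positive because the origin is inside. *)
Lemma kahler_einstein_triangle (R : realType) (P : set NQ) :
  kahler_einstein R P -> triangle P -> exists a b c : 'rV[int]_2,
  centred_triangle P a b c.
Proof.
move=> [[lP P0 coP] bary] triP.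
have [s [us PE vE]] := hull_of_vertices lP.
have := three_elements us; rewrite -vE => /(_ triP).
case: s us PE vE => [|a [|b [|c []]]]//= _; rewrite lattice_seq3 => PE vE _.
exists a, b, c.
have nz v : vertices P (lattice_pt v) -> lattice_pt v != 0.
  by move=> /coP /coprime_neq0.
have an0 : lattice_pt a != 0 by apply: nz; rewrite vE; left; left.
have bn0 : lattice_pt b != 0 by apply: nz; rewrite vE; left; right.
have cn0 : lattice_pt c != 0 by apply: nz; rewrite vE; right.
rewrite /centred_triangle.
move: (lattice_pt a) (lattice_pt b) (lattice_pt c) PE vE an0 bn0 cn0
  => x y z PE vE xn0 yn0 zn0.
have PE2 : P = conv_hull [set y; z; x] by rewrite PE -setUA setUC.
have s1 : 0 < cross x y * cross y z by apply: cross_same_sign => //; rewrite -PE.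
have s2 : 0 < cross y z * cross z x by apply: cross_same_sign => //; rewrite -PE2.
set dz := cross x y in s1 *; set dx := cross y z in s1 s2 *; set dy := cross z x in s2 *.
have dzn0 : dz != 0 by apply: contraTneq s1 => ->; rewrite mul0r ltxx.
have dxn0 : dx != 0 by apply: contraTneq s2 => ->; rewrite mul0r ltxx.
have dyn0 : dy != 0 by apply: contraTneq s2 => ->; rewrite mulr0 ltxx.
pose S := dx + dy + dz.
have dxx : 0 < dx * dx by rewrite -expr2 exprn_even_gt0.
have dxS : 0 < dx * S by rewrite /S; nra.
have Sn0 : S != 0 by apply: contraTneq dxS => ->; rewrite mulr0 ltxx.
have pos d : 0 < dx * d -> 0 < d / S.
  have -> : d / S = (dx * d) / (dx * S) by field; rewrite Sn0 dxn0.
  by move=> h; rewrite divr_gt0.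
have [b' b0 Pb] := @dual_in_box R P P0.
have [a' a0 aP] := box_in_halfplanes (real_pt R x) (real_pt R y) (real_pt R z).
have ratr_eq0 (t : rat) : t = 0 -> ratr t = 0 :> R by move=> ->; rewrite rmorph0.
have := @equal_weights R (real_pt R x) (real_pt R y) (real_pt R z)
  (ratr (dx / S)) (ratr (dy / S)) (ratr (dz / S)) a' b'.
rewrite -dual_conv_hull3 -PE in aP *.
case.
- by rewrite ltr0q; apply: pos.
- by rewrite ltr0q; apply: pos.
- by rewrite ltr0q; apply: pos; rewrite mulrC.
- by rewrite -!rmorphD -(rmorph1 (@ratr R)) /=; congr ratr; rewrite /S; field.
- rewrite /real_pt /= -!rmorphM -!rmorphD /=; apply: ratr_eq0.
  by rewrite /S /dx /dy /dz /cross; field.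
- rewrite /real_pt /= -!rmorphM -!rmorphD /=; apply: ratr_eq0.
  by rewrite /S /dx /dy /dz /cross; field.
- by rewrite /real_pt /= -!rmorphM -!rmorphB fmorph_eq0.
- by rewrite /real_pt /= -!rmorphM -!rmorphB fmorph_eq0.
- by rewrite /real_pt /= -!rmorphM -!rmorphB fmorph_eq0.
- exact: a0.
- exact: b0.
- exact: aP.
- exact: Pb.
- exact: bary.
move=> /fmorph_inj/(mulIf (invr_neq0 Sn0)) xy /fmorph_inj/(mulIf (invr_neq0 Sn0)) yz.
split=> //; apply: (scalerI dxn0); rewrite scaler0.
have -> : dx *: (x + y + z) = dx *: x + dy *: y + dz *: z.
  by rewrite -yz -xy !scalerDr.
by apply: row2_eq; rewrite !mxE /dx /dy /dz /cross; ring.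
Qed.

(** * Linear forms on a mutation *)

Definition wint (w : int * int) (v : 'rV[int]_2) : int := w.1 * v 0 0 + w.2 * v 0 1.

Lemma weval_lattice w v : weval w (lattice_pt v) = (wint w v)%:~R.
Proof. by rewrite /weval /pairing !mxE /wint rmorphD !rmorphM. Qed.

Lemma wevalD w (x y : NQ) : weval w (x + y) = weval w x + weval w y.
Proof. exact: pairingD. Qed.

Lemma wevalZ w t (x : NQ) : weval w (t *: x) = t * weval w x.
Proof. exact: pairingZ. Qed.

Lemma pairingN (u : rat * rat) (x : NQ) : pairing (- u.1, - u.2) x = - pairing u x.
Proof. by rewrite /pairing /=; ring. Qed.

Lemma pairingB (u v : rat * rat) (k : rat) (x : NQ) :
  pairing (u.1 - k * v.1, u.2 - k * v.2) x = pairing u x - pairing v x * k.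
Proof. by rewrite /pairing /=; ring. Qed.

Lemma min_of_three (T : Type) (f : T -> int) (a b c : T) :
  exists v, [/\ v = a \/ v = b \/ v = c, f v <= f a, f v <= f b & f v <= f c].
Proof.
have [ab|ba] := leP (f a) (f b).
  have [ac|ca] := leP (f a) (f c); first by exists a; split=> //; left.
  exists c; split=> //; [by right; right|exact: ltW|exact: ltW (lt_le_trans ca ab)].
have [bc|cb] := leP (f b) (f c).
  by exists b; split=> //; [right; left|exact: ltW].
by exists c; split=> //; [right; right|exact: ltW (lt_trans cb ba)|exact: ltW].
Qed.

Section TriangleHeights.
Variables (w : int * int) (P : set NQ) (a b c : 'rV[int]_2).
Hypothesis PE : P = conv_hull [set lattice_pt a; lattice_pt b; lattice_pt c].

Lemma triangle_vertex v : v = a \/ v = b \/ v = c -> P (lattice_pt v).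
Proof.
by rewrite PE => -[->|[->|->]]; apply: sub_conv_hull; [left; left|left; right|right].
Qed.

Lemma hmin_le v : P (lattice_pt v) -> hmin w P <= wint w v.
Proof.
move=> Pv; rewrite -(ler_int rat) -weval_lattice.
suff [_ lb] : (weval w @` P) (hmin w P)%:~R /\ lbound (weval w @` P) (hmin w P)%:~R.
  by apply: lb; exists (lattice_pt v).
apply: (@xgetPex _ 0 [set h : int | (weval w @` P) h%:~R /\ lbound (weval w @` P) h%:~R]).
have [m [/triangle_vertex Pm ma mb mc]] := min_of_three (wint w) a b c.
exists (wint w m); split; first by exists (lattice_pt m); rewrite ?weval_lattice.
move=> _ [x + <-]; rewrite PE; move: x; apply: conv_hull_pairing => x [[]|] ->;
  by rewrite -/(weval w _) weval_lattice ler_int.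
Qed.

Lemma le_hmax v : P (lattice_pt v) -> wint w v <= hmax w P.
Proof.
move=> Pv; rewrite -(ler_int rat) -weval_lattice.
suff [_ ub] : (weval w @` P) (hmax w P)%:~R /\ ubound (weval w @` P) (hmax w P)%:~R.
  by apply: ub; exists (lattice_pt v).
apply: (@xgetPex _ 0 [set h : int | (weval w @` P) h%:~R /\ ubound (weval w @` P) h%:~R]).
have [m [/triangle_vertex Pm ma mb mc]] := min_of_three (fun v => - wint w v) a b c.
exists (wint w m); split; first by exists (lattice_pt m); rewrite ?weval_lattice.
move=> _ [x + <-].
pose u : rat * rat := (w.1%:~R, w.2%:~R).
rewrite -[weval w x]opprK -(pairingN u) lerNl PE; move: x.
apply: conv_hull_pairing => x [[]|] ->; rewrite pairingN lerN2 -/(weval w _) weval_lattice ler_int -lerN2 //.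
Qed.

End TriangleHeights.

Lemma slice_sub (w : int * int) (A : set NQ) h :
  slice w (conv_hull A) h `<=` conv_hull A.
Proof. by apply: conv_hullS => x []. Qed.

Lemma slice_weval (w : int * int) (P : set NQ) h x :
  slice w P h x -> weval w x = h%:~R.
Proof.
move: x; apply: conv_hull_min => [x y t /= xh yh _ _|x [_ [v /= vh <-]]//].
by rewrite wevalD !wevalZ xh yh; ring.
Qed.

Section Mutation.
Variables (w : int * int) (A F : set NQ) (Rh : int -> set NQ).
Let P := conv_hull A.
Hypothesis remR : remainders w P F Rh.

Lemma remainder_shift (h : int) x f : hmin w P <= h -> h < 0 -> Rh h x -> F f ->
  slice w P h (x - h%:~R *: f).
Proof.
move=> mh h0 xR Ff; have [_ _ sub] := remR mh h0; apply: sub.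
exists x => //; exists (`|h|%:~R *: f); first by exists f.
by rewrite ltr0_norm// rmorphN scaleNr.
Qed.

(** Below height 0, [x - h g] lies in [P] for [x] in the remainder at height
    [h]; above, [P_h + h F] is tested at the minimum [g] of the form on [F]. *)
Lemma mut_pairing (u : rat * rat) (k : rat) (g : NQ) :
  F g -> (forall f, F f -> weval w f = 0) ->
  (forall f, F f -> pairing u g <= pairing u f) ->
  (forall x, P x -> k <= pairing u x) ->
  forall x, mut w P F Rh x -> k <= pairing u x - weval w x * pairing u g.
Proof.
move=> Fg wF ming kP x.
pose ut : rat * rat := (u.1 - pairing u g * w.1%:~R, u.2 - pairing u g * w.2%:~R).
have utE y : pairing ut y = pairing u y - weval w y * pairing u g.
  exact: (pairingB u (w.1%:~R, w.2%:~R)).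
rewrite -utE; move: x; apply: conv_hull_pairing => x; rewrite utE.
case=> [[h /= /andP[mh hN1] xR]|[h /= /andP[h0 hM] [p ph [_ [f Ff <-] <-]]]].
  have h0 : h < 0 by apply: le_lt_trans hN1 _.
  have sx := remainder_shift mh h0 xR Fg.
  have wx : weval w x = h%:~R.
    have := slice_weval sx.
    by rewrite -scaleNr wevalD wevalZ (wF _ Fg) mulr0 addr0.
  have := kP _ (slice_sub sx).
  by rewrite wx -scaleNr pairingD pairingZ mulNr.
rewrite wevalD wevalZ (wF _ Ff) mulr0 addr0 (slice_weval ph) pairingD pairingZ.
have h0' : 0 <= h%:~R :> rat by rewrite ler0z.
have := kP _ (slice_sub ph); have := ming _ Ff; nra.
Qed.

(** For a negative height [h] write [v = r - h f] with [r] in the remainder.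
    Since [r - h g] lies in [P] too, minimality of [v] forces [f = g]. *)
Lemma mut_vertex (u : rat * rat) (v : 'rV[int]_2) (g : NQ) :
  F g ->
  (forall f, F f -> pairing u f <= pairing u g -> f = g) ->
  vertices P (lattice_pt v) ->
  (forall x, P x -> pairing u (lattice_pt v) <= pairing u x) ->
  hmin w P <= wint w v -> wint w v <= hmax w P ->
  mut w P F Rh (lattice_pt v + (wint w v)%:~R *: g).
Proof.
move=> Fg ming vv minv mh hM; set h := wint w v in mh hM *.
apply: sub_conv_hull.
have vh : level w h (lattice_pt v) by exists v => //; exact: weval_lattice.
have [h0|h0] := leP 0 h.
  right; exists h; first by rewrite /= h0 hM.
  exists (lattice_pt v); first by apply: sub_conv_hull; split=> //; case: vv.
  by exists (h%:~R *: g) => //; exists g.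
left; exists h; first by rewrite /= mh /= -ltzD1.
have [_ vsub _] := remR mh h0.
have [x xR [_ [f Ff <-] xE]] := vsub _ (conj vv vh).
have h0' : h%:~R < 0 :> rat by rewrite ltrz0.
have xE' : lattice_pt v = x - h%:~R *: f.
  by rewrite -xE ltr0_norm// rmorphN scaleNr.
have := minv _ (slice_sub (remainder_shift mh h0 xR Fg)).
rewrite {1}xE' -!scaleNr !pairingD !pairingZ => le1.
have fg : f = g by apply: ming => //; nra.
by rewrite xE' fg subrK.
Qed.

End Mutation.

(** * Boundary points, edges and factors *)

Lemma pairing_near (u : rat * rat) (x : NQ) (d : rat) : 0 < d ->
  \forall y \near x, `|pairing u y - pairing u x| < d.
Proof.
move=> d0; pose n := `|u.1| + `|u.2| + 1.
have n0 : 0 < n by rewrite ltr_wpDl// addr_ge0.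
apply/nbhs_ballP; exists (d / n); first exact: divr_gt0.
move=> y [_ xy].
have h i : `|y 0 i - x 0 i| < d / n by rewrite distrC; exact: xy.
have -> : pairing u y - pairing u x = u.1 * (y 0 0 - x 0 0) + u.2 * (y 0 1 - x 0 1).
  by rewrite /pairing; ring.
apply: le_lt_trans (ler_normD _ _) _; rewrite !normrM.
apply: (@le_lt_trans _ _ ((`|u.1| + `|u.2|) * (d / n))).
  by rewrite mulrDl lerD// ler_wpM2l// ltW// h.
by rewrite mulrA ltr_pdivrMr// mulrC ltr_pM2l// /n ltrDl.
Qed.

(** Moving from [x] against [d] leaves [Q] at once. *)
Lemma boundary_support (Q : set NQ) (u : rat * rat) (k : rat) (x d : NQ) :
  Q x -> (forall y, Q y -> k <= pairing u y) -> pairing u x = k ->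
  0 < pairing u d -> (closure Q `\` Q°) x.
Proof.
move=> Qx Qk ux ud; split; first exact: subset_closure.
move=> /interior_square[eps eps0 sub].
pose n := `|d 0 0| + `|d 0 1| + 1.
have n0 : 0 < n by rewrite ltr_wpDl// addr_ge0.
have en : 0 < eps / n by rewrite divr_gt0.
have h i : `|d 0 i| <= n -> `|(x - (eps / n) *: d) 0 i - x 0 i| <= eps.
  move=> dn; rewrite !mxE addrC addKr normrN normrM (gtr0_norm en) mulrAC.
  by rewrite ler_pdivrMr// ler_pM2l.
have Qy : Q (x - (eps / n) *: d).
  apply: sub; apply: h; rewrite /n; first by rewrite -addrA lerDl addr_ge0.
  by rewrite addrAC lerDr addr_ge0.
have := Qk _ Qy; rewrite -scaleNr pairingD pairingZ ux; nra.
Qed.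

Lemma boundary_of_halfplanes (u v t : rat * rat) (k : rat) (x : NQ) :
  let P := [set y : NQ | [/\ k <= pairing u y, k <= pairing v y & k <= pairing t y]] in
  (closure P `\` P°) x ->
  P x /\ (pairing u x = k \/ pairing v x = k \/ pairing t x = k).
Proof.
move=> P [clx nix].
have half s : (forall y, P y -> k <= pairing s y) -> k <= pairing s x.
  move=> Ps; rewrite leNgt; apply/negP => sx.
  have d0 : 0 < k - pairing s x by rewrite subr_gt0.
  have [y [Py /= hy]] := clx _ (pairing_near s x d0).
  by have := Ps _ Py; move: hy; rewrite ltr_norml; lra.
have Px : P x by split; apply: half => y [].
split=> //; case: Px => ux vx tx.
have [|un] := eqVneq (pairing u x) k; first by left.
have [|vn] := eqVneq (pairing v x) k; first by right; left.
have [|tn] := eqVneq (pairing t x) k; first by right; right.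
have pos s : k <= pairing s x -> pairing s x != k -> 0 < pairing s x - k.
  by move=> h hn; rewrite subr_gt0 lt_neqAle eq_sym hn.
case: nix.
have nu := pairing_near u x (pos _ ux un).
have nv := pairing_near v x (pos _ vx vn).
have nt := pairing_near t x (pos _ tx tn).
rewrite /interior; near=> y.
split.
- by have : `|pairing u y - pairing u x| < pairing u x - k; [near: y|rewrite ltr_norml; lra].
- by have : `|pairing v y - pairing v x| < pairing v x - k; [near: y|rewrite ltr_norml; lra].
- by have : `|pairing t y - pairing t x| < pairing t x - k; [near: y|rewrite ltr_norml; lra].
Unshelve. all: by end_near. Qed.

(** The form with value -1 at [b] and [c]. *)
Definition line_form (b c : NQ) : rat * rat :=
  ((b 0 1 - c 0 1) / cross b c, (c 0 0 - b 0 0) / cross b c).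

Lemma line_formE b c x :
  pairing (line_form b c) x = cross x (b - c) / cross b c.
Proof. by rewrite /pairing /line_form /cross !mxE /=; ring. Qed.

Section Triangle.
Variables a b c : NQ.
Hypothesis abc0 : a + b + c = 0.
Hypothesis ab_neq0 : cross a b != 0.

Let cE i : c 0 i = - a 0 i - b 0 i.
Proof. by have /matrixP/(_ 0 i) := abc0; rewrite !mxE; lra. Qed.

Lemma cross_cyclic : cross b c = cross a b.
Proof. by rewrite /cross !cE; ring. Qed.

Lemma line_form_values :
  [/\ pairing (line_form a b) a = -1, pairing (line_form a b) b = -1
    & pairing (line_form a b) c = 2].
Proof.
have d0 : a 0 0 * b 0 1 - a 0 1 * b 0 0 != 0 by exact: ab_neq0.
by split; rewrite line_formE /cross !mxE ?cE; field; rewrite ?d0.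
Qed.

Lemma line_form_sum x : pairing (line_form a b) x + pairing (line_form b c) x +
  pairing (line_form c a) x = 0.
Proof.
have d0 : a 0 0 * b 0 1 - a 0 1 * b 0 0 != 0 by exact: ab_neq0.
have ca : cross c a = cross a b by rewrite /cross !cE; ring.
rewrite !line_formE ca cross_cyclic /cross !mxE !cE; field; exact: d0.
Qed.

Lemma line_form_inj x y : pairing (line_form a b) x = pairing (line_form a b) y ->
  pairing (line_form b c) x = pairing (line_form b c) y -> x = y.
Proof.
have d0 : a 0 0 * b 0 1 - a 0 1 * b 0 0 != 0 by exact: ab_neq0.
rewrite !line_formE cross_cyclic => /(mulIf (invr_neq0 ab_neq0)) e1
  /(mulIf (invr_neq0 ab_neq0)); move: e1; rewrite /cross !mxE !cE.
move: (x 0 0) (x 0 1) (y 0 0) (y 0 1) (@row2_eq _ x y) d0.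
move: (a 0 0) (a 0 1) (b 0 0) (b 0 1) => a0 a1 b0 b1 x0 x1 y0 y1 xy d0 e1 e2.
have D3 : 3 * (a0 * b1 - a1 * b0) != 0 by rewrite mulf_neq0.
apply: xy; apply: (mulIf D3).
  transitivity (x0 * (3 * (a0 * b1 - a1 * b0))); first by [].
  have -> : x0 * (3 * (a0 * b1 - a1 * b0)) =
    (x0 * (b1 - (- a1 - b1)) - x1 * (b0 - (- a0 - b0))) * (a0 - b0) -
    (x0 * (a1 - b1) - x1 * (a0 - b0)) * (b0 - (- a0 - b0)) by ring.
  by rewrite e1 e2; ring.
have -> : x1 * (3 * (a0 * b1 - a1 * b0)) =
  (x0 * (b1 - (- a1 - b1)) - x1 * (b0 - (- a0 - b0))) * (a1 - b1) -
  (x0 * (a1 - b1) - x1 * (a0 - b0)) * (b1 - (- a1 - b1)) by ring.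
by rewrite e1 e2; ring.
Qed.
End Triangle.

Lemma conv_hull3 (A : set NQ) (a b c : NQ) (r s t : rat) :
  conv_hull A a -> conv_hull A b -> conv_hull A c ->
  0 <= r -> 0 <= s -> 0 <= t -> r + s + t = 1 ->
  conv_hull A (r *: a + s *: b + t *: c).
Proof.
move=> Aa Ab Ac r0 s0 t0 rst.
have [rs0|rsn0] := eqVneq (r + s) 0.
  have r_eq0 : r = 0 by lra.
  have s_eq0 : s = 0 by lra.
  have -> : t = 1 by lra.
  by rewrite r_eq0 s_eq0 !scale0r !add0r scale1r.
have rs_gt0 : 0 < r + s by rewrite lt_neqAle eq_sym rsn0 addr_ge0.
have -> : r *: a + s *: b + t *: c =
  (r + s) *: ((r / (r + s)) *: a + (1 - r / (r + s)) *: b) + (1 - (r + s)) *: c.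
  rewrite (_ : 1 - (r + s) = t); last by lra.
  congr (_ + _); rewrite scalerDr !scalerA mulrC divfK// mulrBr mulr1.
  by rewrite [(r + s) * _]mulrC divfK// [r + s]addrC addrK.
apply: conv_hull_convex => //; [|lra|lra].
apply: conv_hull_convex => //; first by rewrite divr_ge0// ltW.
by rewrite ler_pdivrMr//; lra.
Qed.

Lemma triangle_halfplanes (a b c : NQ) : a + b + c = 0 -> cross a b != 0 ->
  conv_hull [set a; b; c] = [set y : NQ | [/\ -1 <= pairing (line_form a b) y,
    -1 <= pairing (line_form b c) y & -1 <= pairing (line_form c a) y]].
Proof.
move=> abc0 ab0.
have bca0 : b + c + a = 0 by rewrite addrC addrA.
have bc0 : cross b c != 0 by rewrite (cross_cyclic abc0).
have cab0 : c + a + b = 0 by rewrite addrC addrA.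
have ca0 : cross c a != 0 by rewrite (cross_cyclic bca0).
have [ca cb cc] := line_form_values abc0 ab0.
have [ab ac aa] := line_form_values bca0 bc0.
have [bc ba bb] := line_form_values cab0 ca0.
apply/seteqP; split=> x.
  move=> Px; split; move: x Px; apply: conv_hull_pairing => x [[]|] ->; lra.
move=> /= [h1 h2 h3]; have := line_form_sum abc0 ab0 x => sum0.
pose p : rat := pairing (line_form a b) x.
pose q : rat := pairing (line_form b c) x.
pose r : rat := pairing (line_form c a) x.
rewrite -/p in h1 sum0; rewrite -/q in h2 sum0; rewrite -/r in h3 sum0.
have -> : x = ((q + 1) / 3) *: a + ((r + 1) / 3) *: b + ((p + 1) / 3) *: c.
  apply: (line_form_inj abc0 ab0); rewrite !pairingD !pairingZ.
    by rewrite ca cb cc -/p; lra.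
  by rewrite aa ab ac -/q; lra.
apply: conv_hull3.
- by apply: sub_conv_hull; left; left.
- by apply: sub_conv_hull; left; right.
- by apply: sub_conv_hull; right.
- lra.
- lra.
- lra.
- lra.
Qed.

Section Direction.
Variable w : int * int.
Hypothesis w_prim : primitive w.

Definition direction : 'rV[int]_2 := \row_j (if j == 0 then - w.2 else w.1).

Lemma weval_direction : weval w (lattice_pt direction) = 0.
Proof. by rewrite weval_lattice /wint !mxE /=; apply/eqP; rewrite intr_eq0; lia. Qed.

(** A Bezout relation for [w] gives the coefficient. *)
Lemma height0_multiple (v : 'rV[int]_2) : wint w v = 0 -> exists m : int, v = m *: direction.
Proof.
move=> wv; have /coprimezP[[p q] /= pq] := w_prim.
move: wv; rewrite /wint => wv.
exists (p * v 0 1 - q * v 0 0); apply: row2_eq; rewrite !mxE /=.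
  transitivity (v 0 0 * (p * w.1 + q * w.2) - p * (w.1 * v 0 0 + w.2 * v 0 1)).
    by rewrite pq wv mulr1 mulr0 subr0.
  by ring.
transitivity (v 0 1 * (p * w.1 + q * w.2) - q * (w.1 * v 0 0 + w.2 * v 0 1)).
  by rewrite pq wv mulr1 mulr0 subr0.
by ring.
Qed.
End Direction.

Lemma lattice_ptD (u v : 'rV[int]_2) : lattice_pt (u + v) = lattice_pt u + lattice_pt v.
Proof. by apply/matrixP => i j; rewrite !mxE rmorphD. Qed.

Lemma lattice_ptN (u : 'rV[int]_2) : lattice_pt (- u) = - lattice_pt u.
Proof. by apply/matrixP => i j; rewrite !mxE rmorphN. Qed.

Lemma lattice_ptZ (m : int) (u : 'rV[int]_2) : lattice_pt (m *: u) = m%:~R *: lattice_pt u.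
Proof. by apply/matrixP => i j; rewrite !mxE rmorphM. Qed.

Lemma exists_min_int (x : int) (s : seq int) : exists2 m, m \in x :: s &
  forall y, y \in x :: s -> m <= y.
Proof.
elim: s x => [x|y s IH x]; first by exists x; rewrite ?mem_head// => y; rewrite inE => /eqP ->.
have [m ms mle] := IH y.
have [xm|mx] := leP x m.
  exists x; rewrite ?mem_head// => z; rewrite inE => /orP[/eqP ->//|/mle].
  exact: le_trans.
exists m; first by rewrite inE ms orbT.
by move=> z; rewrite inE => /orP[/eqP ->|/mle//]; exact: ltW.
Qed.

Lemma factor_segment (w : int * int) (F : set NQ) : primitive w ->
  lattice_polytope F -> weval w @` F = [set 0] ->
  exists al be : int, let e := lattice_pt (direction w) in
  [/\ F (al%:~R *: e), F (be%:~R *: e) &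
    forall f, F f -> exists2 t : rat, f = t *: e & al%:~R <= t <= be%:~R].
Proof.
move=> pw [s FE] wF; pose e := lattice_pt (direction w).
have w0 f : F f -> weval w f = 0.
  move=> Ff; have : (weval w @` F) (weval w f) by exists f.
  by rewrite wF.
have /choice[m mE] : forall v, exists k : int, v \in s -> v = k *: direction w.
  move=> v.
  have [vs|] := boolP (v \in s); last by exists 0.
  have [|k kE] := @height0_multiple w pw v; last by exists k.
  apply/eqP; rewrite -(intr_eq0 rat) -weval_lattice; apply/eqP/w0.
  by rewrite FE; apply: sub_conv_hull; exists v.
have sF v : v \in s -> F ((m v)%:~R *: e).
  move=> vs; rewrite -lattice_ptZ -mE// FE; apply: sub_conv_hull.
  by exists v.
have : F !=set0.
  by have : (weval w @` F) 0; [rewrite wF|case=> f Ff _; exists f].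
case: s FE mE sF => [|v s] FE mE sF.
  rewrite FE (_ : [set lattice_pt v | v in _] = set0) ?conv_hull0; first by case.
  by apply/seteqP; split=> // x [].
move=> _.
have [al /(@mapP _ _ m (v :: s))[a as_ alE] mal] := exists_min_int (m v) (map m s).
have [be' /(@mapP _ _ (fun v => - m v) (v :: s))[b bs beE] mbe] :=
  exists_min_int (- m v) [seq - m v | v <- s].
exists (m a), (m b); split; [exact: sF|exact: sF|].
rewrite FE; apply: conv_hull_min => [x y t [p -> /andP[ap pb]] [q -> /andP[aq qb]] t0 t1|].
  exists (t * p + (1 - t) * q); first by rewrite !scalerA -scalerDl.
  by apply/andP; split; nra.
move=> _ [u /= us <-]; exists (m u)%:~R; first by rewrite -lattice_ptZ -mE.
rewrite !ler_int -alE mal ?(map_f m us)//=.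
by rewrite -lerN2 -beE mbe// (map_f (fun v => - m v) us).
Qed.

(** * Mutations of a triangle with centroid 0 *)

Lemma card_le_inj (T U : Type) (A : set T) (B : set U) (g : T -> U) :
  (forall x, A x -> B (g x)) ->
  (forall x y, A x -> A y -> g x = g y -> x = y) -> (A #<= B)%card.
Proof.
move=> AB ginj; apply: (card_le_trans (B := g @` A)); last first.
  by apply: subset_card_le => _ [x Ax <-]; exact: AB.
have : (g @` A #= A)%card by apply: inj_card_eq => x y /set_mem Ax /set_mem Ay; exact: ginj.
by rewrite card_eq_sym card_eq_le => /andP[].
Qed.

Lemma conv_hull_shear (S A : set NQ) (w : int * int) (g x : NQ) :
  (forall s, S s -> conv_hull A (s + weval w s *: g)) -> conv_hull S x ->
  conv_hull A (x + weval w x *: g).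
Proof.
move=> SA; move: x; apply: conv_hull_min SA => x y t Ax Ay t0 t1.
have -> : t *: x + (1 - t) *: y + weval w (t *: x + (1 - t) *: y) *: g =
    t *: (x + weval w x *: g) + (1 - t) *: (y + weval w y *: g).
  by rewrite wevalD !wevalZ !scalerDr !scalerA (scalerDl g) addrACA.
exact: conv_hull_convex.
Qed.

(** A boundary point of the triangle has coordinates [(x, y)], the values of the
    forms that are -1 on the left edge and on the bottom edge; the vertices [a],
    [b], [c] are [(-1, -1)], [(2, -1)], [(-1, 2)].  [p] and [q] measure the two
    ends of the factor along the bottom edge, which loses the length [q - p].
    The four cases: left edge, right edge, the part of the bottom edge that
    stays, and the part that goes to the top edge [y' = 2]. *)
Definition moved_by (p q x y x' y' : rat) : Prop :=
  -1 <= y <= 2 /\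
  [\/ [/\ x = -1, x' = -1 + y * p & y' = y],
     [/\ x = 1 - y, -1 < y < 2, x' = 1 - y + y * q & y' = y],
     [/\ y = -1, -1 < x <= 2 - (q - p), x' = x - p & y' = -1]
   | [/\ y = -1, 2 - (q - p) < x <= 2, x' = x + p + q - 3 & y' = 2]].

Lemma moved_by_inj (p q x y x2 y2 x' y' : rat) :
  p < q -> q - p <= 3 ->
  moved_by p q x y x' y' -> moved_by p q x2 y2 x' y' -> x = x2 /\ y = y2.
Proof.
move=> pq pq3.
(* At a height strictly between bottom and top, the images of the left and of
   the right edge differ by this amount. *)
have LR t : -1 < t -> t < 2 -> 0 < 2 - t + t * (q - p).
  by move=> h1 h2; have [t0|t0] := leP 0 t; nra.
case=> /andP[y1 y3] s1 [/andP[y4 y5] s2].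
case: s1 => [[e1 e2 e3]|[e1 /andP[e2 e3] e4 e5]|[e1 /andP[e2 e3] e4 e5]|[e1 /andP[e2 e3] e4 e5]];
  case: s2 => [[f1 f2 f3]|[f1 /andP[f2 f3] f4 f5]|[f1 /andP[f2 f3] f4 f5]|[f1 /andP[f2 f3] f4 f5]];
  try (by split; lra); exfalso; try lra.
- have yE : y = y2 by lra.
  by rewrite yE in e2; have := LR y2 f2 f3; lra.
- have yE : y = -1 by lra.
  by rewrite yE in e2; lra.
- have yE : y = 2 by lra.
  by rewrite yE in e2; lra.
- have yE : y2 = y by lra.
  by rewrite yE in f2; have := LR y e2 e3; lra.
- have yE : y2 = -1 by lra.
  by rewrite yE in f2; lra.
- have yE : y2 = 2 by lra.
  by rewrite yE in f2; lra.
Qed.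

Section TriangleMutation.
Variables (w : int * int) (a b c : 'rV[int]_2) (P F : set NQ) (Rh : int -> set NQ).
Let A := lattice_pt a.
Let B := lattice_pt b.
Let C := lattice_pt c.
Let E := lattice_pt (direction w).
Let Q := mut w P F Rh.
Hypothesis PE : P = conv_hull [set A; B; C].
Hypothesis abc0 : A + B + C = 0.
Hypothesis ab0 : cross A B != 0.
Hypothesis vP : vertices P = [set A; B; C].
Hypothesis remR : remainders w P F Rh.
Variables al be : int.
Hypothesis Fal : F (al%:~R *: E).
Hypothesis Fbe : F (be%:~R *: E).
Hypothesis Fseg : forall f, F f -> exists2 t : rat, f = t *: E & al%:~R <= t <= be%:~R.

Let bca0 : B + C + A = 0. Proof. by rewrite addrC addrA. Qed.
Let bc0 : cross B C != 0. Proof. by rewrite (cross_cyclic abc0). Qed.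
Let cab0 : C + A + B = 0. Proof. by rewrite addrC addrA. Qed.
Let ca0 : cross C A != 0. Proof. by rewrite (cross_cyclic bca0). Qed.

Lemma factor_height0 f : F f -> weval w f = 0.
Proof. by move=> /Fseg[t -> _]; rewrite wevalZ weval_direction mulr0. Qed.

Lemma boundary_triangle v : boundary_lattice_pts P v ->
  P (lattice_pt v) /\ (pairing (line_form A B) (lattice_pt v) = -1 \/
    pairing (line_form B C) (lattice_pt v) = -1 \/
    pairing (line_form C A) (lattice_pt v) = -1).
Proof.
rewrite /boundary_lattice_pts /= PE triangle_halfplanes//.
exact: boundary_of_halfplanes.
Qed.

Lemma triangle_ge x : P x -> [/\ -1 <= pairing (line_form A B) x,
    -1 <= pairing (line_form B C) x & -1 <= pairing (line_form C A) x].
Proof. by rewrite PE triangle_halfplanes. Qed.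

Let mutP (u : rat * rat) (k : rat) (g : NQ) :
  F g -> (forall f, F f -> pairing u g <= pairing u f) ->
  (forall x, P x -> k <= pairing u x) ->
  forall x, Q x -> k <= pairing u x - weval w x * pairing u g.
Proof.
have := remR; rewrite /Q PE => rR Fg gmin kP.
exact: (mut_pairing rR Fg factor_height0 gmin kP).
Qed.

Let mutV (u : rat * rat) (v : 'rV[int]_2) (g : NQ) :
  F g -> (forall f, F f -> pairing u f <= pairing u g -> f = g) ->
  v = a \/ v = b \/ v = c ->
  (forall x, P x -> pairing u (lattice_pt v) <= pairing u x) ->
  Q (lattice_pt v + weval w (lattice_pt v) *: g).
Proof.
move=> Fg gmin vabc vmin.
have Pv := triangle_vertex PE vabc.
have mh := hmin_le w PE Pv; have hM := le_hmax w PE Pv.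
have vv : vertices P (lattice_pt v).
  by rewrite vP; case: vabc => [->|[->|->]]; [left; left|left; right|right].
rewrite weval_lattice; move: remR Pv mh hM vv vmin; rewrite /Q PE.
by move=> rR Pv mh hM vv vmin; apply: (mut_vertex rR Fg gmin vv vmin).
Qed.

Definition shear (k : int) (v : 'rV[int]_2) := v + (wint w v * k) *: direction w.

Lemma lattice_shear k v :
  lattice_pt (shear k v) = lattice_pt v + weval w (lattice_pt v) *: (k%:~R *: E).
Proof. by rewrite lattice_ptD lattice_ptZ weval_lattice rmorphM scalerA. Qed.

Lemma wint_shear k v : wint w (shear k v) = wint w v.
Proof.
apply/eqP; rewrite -(eqr_int rat) -!weval_lattice lattice_shear wevalD !wevalZ.
by rewrite weval_direction !mulr0 addr0.
Qed.

Lemma shear_inj k : injective (shear k).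
Proof.
move=> u v uv; have := congr1 (wint w) uv; rewrite !wint_shear => wuv.
by move: uv; rewrite /shear wuv => /addIr.
Qed.

Lemma shear_boundary (u : rat * rat) (k : int) (v : 'rV[int]_2) (d : NQ) :
  F (k%:~R *: E) ->
  (forall f, F f -> pairing u (k%:~R *: E) <= pairing u f) ->
  (forall x, P x -> -1 <= pairing u x) ->
  pairing u (lattice_pt v) = -1 -> Q (lattice_pt (shear k v)) ->
  0 < pairing u d - weval w d * pairing u (k%:~R *: E) ->
  boundary_lattice_pts Q (shear k v).
Proof.
move=> Fk kmin uP uv Qv ud.
pose w' : rat * rat := (w.1%:~R, w.2%:~R).
pose t := pairing u (k%:~R *: E).
apply: (@boundary_support Q (u.1 - t * w'.1, u.2 - t * w'.2) (-1) _ d Qv).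
- by move=> y Qy; rewrite pairingB; exact: mutP.
- rewrite pairingB -[pairing w' _]/(weval w _) weval_lattice wint_shear.
  by rewrite lattice_shear pairingD pairingZ uv weval_lattice /t; ring.
- by rewrite pairingB.
Qed.

(** Tilting by the point [F] is the same for all forms, so the mutation is the
    image of [P] under one shear of the lattice. *)
Lemma translate_mutation : al = be ->
  (boundary_lattice_pts P #<= boundary_lattice_pts Q)%card.
Proof.
move=> ab; pose g := al%:~R *: E.
have Fg f : F f -> f = g.
  by move=> /Fseg[t -> /andP[at_ tb]]; rewrite /g; congr (_ *: _); move: tb at_; rewrite -ab; lra.
have Qv v : v = a \/ v = b \/ v = c -> Q (lattice_pt v + weval w (lattice_pt v) *: g).
  move=> vabc; apply: (mutV (u := (0, 0))) => //; first by move=> f /Fg ->.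
  by move=> x _; rewrite /pairing /= !mul0r.
have QP x : P x -> Q (x + weval w x *: g).
  rewrite PE; apply: conv_hull_shear => s [[]|] ->; apply: Qv; tauto.
have [ca cb cc] := line_form_values abc0 ab0.
have [ab_ ac aa] := line_form_values bca0 bc0.
have [bc ba bb] := line_form_values cab0 ca0.
have edge u v z : (forall x, P x -> -1 <= pairing u x) -> pairing u z = 2 ->
    pairing u (lattice_pt v) = -1 -> P (lattice_pt v) ->
    boundary_lattice_pts Q (shear al v).
  move=> uP uz uv Pv.
  apply: (@shear_boundary u al v (z + weval w z *: g)) => //.
  - by move=> f /Fg ->.
  - by rewrite lattice_shear; exact: QP.
  - by rewrite pairingD pairingZ wevalD wevalZ (factor_height0 Fal) uz /g; lra.
apply: (@card_le_inj _ _ _ _ (shear al)) => [v /boundary_triangle[Pv]|u v _ _].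
  case=> [h|[h|h]].
  - by apply: (@edge (line_form A B) v C) => // x /triangle_ge[].
  - by apply: (@edge (line_form B C) v A) => // x /triangle_ge[].
  - by apply: (@edge (line_form C A) v B) => // x /triangle_ge[].
exact: shear_inj.
Qed.

Section Wide.
Variable l : int.
Hypothesis wE : wint w b = wint w a.
Hypothesis wa_lt0 : wint w a < 0.
Hypothesis bE : b = a + l *: direction w.
Hypothesis l_gt0 : 0 < l.
Hypothesis al_be : al < be.

Let uC := line_form A B.
Let uL := line_form C A.
Let uR := line_form B C.
Let h : rat := - (wint w a)%:~R.
Let kap : rat := 3 / l%:~R.
Let p : rat := h * al%:~R * kap.
Let q : rat := h * be%:~R * kap.

Let h_gt0 : 0 < h. Proof. by rewrite oppr_gt0 ltrz0. Qed.
Let kap_gt0 : 0 < kap. Proof. by rewrite divr_gt0// ltr0z. Qed.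
Let l_neq0 : l%:~R != 0 :> rat. Proof. by rewrite intr_eq0 gt_eqF. Qed.

Let l_kap : l%:~R * kap = 3. Proof. by rewrite /kap mulrC divfK. Qed.

Let BE : B = A + l%:~R *: E.
Proof. by rewrite /B bE lattice_ptD lattice_ptZ. Qed.

Let CA := line_form_values cab0 ca0.
Let AB := line_form_values abc0 ab0.
Let BC := line_form_values bca0 bc0.

Let uLE : pairing uL E = kap.
Proof.
have [_ uLA uLB] := CA; apply: (mulfI l_neq0).
have : pairing uL B = pairing uL A + l%:~R * pairing uL E by rewrite BE pairingD pairingZ.
by rewrite uLA uLB l_kap => e; lra.
Qed.

Let uRE : pairing uR E = - kap.
Proof.
have [uRB _ uRA] := BC; apply: (mulfI l_neq0).
have : pairing uR B = pairing uR A + l%:~R * pairing uR E by rewrite BE pairingD pairingZ.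
by rewrite uRA uRB mulrN l_kap => e; lra.
Qed.

Let uCE : pairing uC E = 0.
Proof.
have [uCA uCB _] := AB; apply: (mulfI l_neq0).
have : pairing uC B = pairing uC A + l%:~R * pairing uC E by rewrite BE pairingD pairingZ.
by rewrite uCA uCB => e; lra.
Qed.

Let weval_uC x : weval w x = h * pairing uC x.
Proof.
have cramer (u : rat * rat) : cross A B * pairing u x =
    cross x B * pairing u A + cross A x * pairing u B.
  by rewrite /cross /pairing; ring.
apply: (mulfI ab0); rewrite mulrCA (cramer uC).
have [-> -> _] := AB.
have -> : cross A B * weval w x = cross x B * weval w A + cross A x * weval w B.
  exact: (cramer (w.1%:~R, w.2%:~R)).
by rewrite !weval_lattice wE /h; ring.
Qed.

Let uRE' x : pairing uR x = - pairing uC x - pairing uL x.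
Proof. by have := line_form_sum abc0 ab0 x; rewrite -/uC -/uR -/uL; lra. Qed.

Let uL_segment f : F f -> pairing uL (al%:~R *: E) <= pairing uL f.
Proof.
by move=> /Fseg[t -> /andP[at_ _]]; rewrite !pairingZ uLE ler_pM2r.
Qed.

Let uR_segment f : F f -> pairing uR (be%:~R *: E) <= pairing uR f.
Proof.
by move=> /Fseg[t -> /andP[_ tb]]; rewrite !pairingZ uRE !mulrN lerN2 ler_pM2r.
Qed.

Let uC_segment f : F f -> pairing uC (al%:~R *: E) <= pairing uC f.
Proof. by move=> /Fseg[t -> _]; rewrite !pairingZ uCE !mulr0. Qed.

Let uL_ge x : P x -> -1 <= pairing uL x. Proof. by move=> /triangle_ge[]. Qed.
Let uR_ge x : P x -> -1 <= pairing uR x. Proof. by move=> /triangle_ge[]. Qed.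
Let uC_ge x : P x -> -1 <= pairing uC x. Proof. by move=> /triangle_ge[]. Qed.

Let Q_left v : v = a \/ v = c ->
  Q (lattice_pt v + weval w (lattice_pt v) *: (al%:~R *: E)).
Proof.
move=> vac; have [uLc uLa _] := CA.
apply: (mutV (u := uL)) => //; last 2 first.
- by case: vac => ->; tauto.
- by move=> x /uL_ge; case: vac => ->; rewrite ?uLc ?uLa.
move=> f /Fseg[t -> /andP[at_ tb]]; rewrite !pairingZ uLE ler_pM2r// => ta.
by congr (_ *: _); apply/eqP; rewrite eq_le ta.
Qed.

Let Q_right v : v = b \/ v = c ->
  Q (lattice_pt v + weval w (lattice_pt v) *: (be%:~R *: E)).
Proof.
move=> vbc; have [uRb uRc _] := BC.
apply: (mutV (u := uR)) => //; last 2 first.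
- by case: vbc => ->; tauto.
- by move=> x /uR_ge; case: vbc => ->; rewrite ?uRb ?uRc.
move=> f /Fseg[t -> /andP[at_ tb]]; rewrite !pairingZ uRE !mulrN lerN2 ler_pM2r// => bt.
by congr (_ *: _); apply/eqP; rewrite eq_le tb.
Qed.

Let p_lt_q : p < q.
Proof. by rewrite /p /q ltr_pM2r// ltr_pM2l// ltr_int. Qed.

(** The sheared vertex [b] lies to the right of the sheared left edge. *)
Let q_sub_p_le3 : q - p <= 3.
Proof.
have [_ _ uLb] := CA; have [_ uCb _] := AB.
have := mutP Fal uL_segment uL_ge (Q_right (or_introl erefl)).
rewrite pairingD wevalD !pairingZ !wevalZ !weval_uC uCE uLE uLb uCb /p /q; lra.
Qed.

Let Q_segment (x y z : NQ) (t : rat) : Q y -> Q z -> 0 <= t -> t <= 1 ->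
  pairing uL x = t * pairing uL y + (1 - t) * pairing uL z ->
  pairing uC x = t * pairing uC y + (1 - t) * pairing uC z -> Q x.
Proof.
move=> Qy Qz t0 t1 xL xC.
have -> : x = t *: y + (1 - t) *: z.
  by apply: (line_form_inj cab0 ca0); rewrite pairingD !pairingZ.
exact: conv_hull_convex.
Qed.

Let shear_uL (k : int) (x : NQ) : pairing uL (x + weval w x *: (k%:~R *: E)) =
  pairing uL x + pairing uC x * (h * k%:~R * kap).
Proof. by rewrite pairingD !pairingZ uLE weval_uC; ring. Qed.

Let shear_uC (k : int) (x : NQ) : pairing uC (x + weval w x *: (k%:~R *: E)) = pairing uC x.
Proof. by rewrite pairingD !pairingZ uCE; ring. Qed.

(** Takes the last point of the bottom edge of [P], the vertex [b], to the point
    of the top edge of the mutation at lattice distance [h (be - al)] from its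
    left end. *)
Let lift_vector := (c - a) + (- wint w a * (al + be) - l) *: direction w.

Let lift_uL : pairing uL (lattice_pt lift_vector) = p + q - 3.
Proof.
have [uLc uLa _] := CA.
rewrite lattice_ptD lattice_ptD lattice_ptN lattice_ptZ -scaleN1r !pairingD !pairingZ.
rewrite uLc uLa uLE /p /q rmorphB rmorphM rmorphD rmorphN /= /h.
by have := l_kap; lra.
Qed.

Let lift_uC : pairing uC (lattice_pt lift_vector) = 3.
Proof.
have [uCa _ uCc] := AB.
rewrite lattice_ptD lattice_ptD lattice_ptN lattice_ptZ -scaleN1r !pairingD !pairingZ.
by rewrite uCa uCc uCE; lra.
Qed.

(** The tests are ordered so that [c] counts as a point of the left edge and [b]
    as a point of the bottom edge. *)
Let boundary_map (v : 'rV[int]_2) : 'rV[int]_2 :=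
  if pairing uL (lattice_pt v) == -1 then shear al v
  else if pairing uC (lattice_pt v) != -1 then shear be v
  else if pairing uL (lattice_pt v) <= 2 - (q - p) then shear al v
  else v + lift_vector.

Let boundary_map_coord v : boundary_lattice_pts P v ->
  moved_by p q (pairing uL (lattice_pt v)) (pairing uC (lattice_pt v))
    (pairing uL (lattice_pt (boundary_map v))) (pairing uC (lattice_pt (boundary_map v))).
Proof.
move=> /boundary_triangle[Pv edge].
have := uL_ge Pv; have := uR_ge Pv; have := uC_ge Pv.
have := uRE' (lattice_pt v).
rewrite -/uC -/uR -/uL in edge.
rewrite /boundary_map; set x := pairing uL _ in edge *; set y := pairing uC _ in edge *.
set z := pairing uR _ in edge * => zE y1 z1 x1; split; first by apply/andP; lra.
have [xN1|xn1] := eqVneq x (-1).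
  by constructor 1; rewrite !lattice_shear shear_uL shear_uC -/x -/y xN1.
have x_gt : -1 < x by rewrite lt_neqAle eq_sym xn1.
have [yN1|yn1] /= := eqVneq y (-1).
  have [xle|xgt] := leP x (2 - (q - p)).
    constructor 3; rewrite lattice_shear shear_uL shear_uC -/x -/y yN1 /p.
    by split=> //; [rewrite x_gt|lra].
  constructor 4; rewrite lattice_ptD !pairingD lift_uL lift_uC -/x -/y yN1.
  by split=> //; lra.
have zN1 : z = -1 by case: edge => [/eqP|[//|/eqP]]; rewrite ?(negbTE xn1) ?(negbTE yn1).
have y_gt : -1 < y by rewrite lt_neqAle eq_sym yn1.
by constructor 2; rewrite lattice_shear shear_uL shear_uC -/x -/y /q; split=> //; lra.
Qed.

Let moved_by_boundary (x y : rat) (z : 'rV[int]_2) :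
  moved_by p q x y (pairing uL (lattice_pt z)) (pairing uC (lattice_pt z)) ->
  boundary_lattice_pts Q z.
Proof.
set Z := lattice_pt z; move=> [/andP[y1 y2] spec].
have [uLc uLa uLb] := CA; have [uCa uCb uCc] := AB.
rewrite -/uL in uLc uLa uLb; rewrite -/uC in uCa uCb uCc.
have pq := p_lt_q; have pq3 := q_sub_p_le3.
(* The edges of the mutation: left, right, bottom and top. *)
have supL (Y : NQ) : Q Y -> -1 <= pairing (uL.1 - p * uC.1, uL.2 - p * uC.2) Y.
  move=> QY; rewrite pairingB.
  have := mutP Fal uL_segment uL_ge QY.
  by rewrite pairingZ uLE weval_uC /p; lra.
have supR (Y : NQ) : Q Y -> -1 <= pairing (uR.1 - (- q) * uC.1, uR.2 - (- q) * uC.2) Y.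
  move=> QY; rewrite pairingB.
  have := mutP Fbe uR_segment uR_ge QY.
  by rewrite pairingZ uRE weval_uC /q; lra.
have supC (Y : NQ) : Q Y -> -1 <= pairing uC Y.
  move=> QY; have := mutP Fal uC_segment uC_ge QY.
  by rewrite pairingZ uCE !mulr0 subr0.
have supN (Y : NQ) : Q Y -> -2 <= pairing (- uC.1, - uC.2) Y.
  move=> QY.
  have fN f : F f -> pairing (- uC.1, - uC.2) (al%:~R *: E) <= pairing (- uC.1, - uC.2) f.
    by move=> /Fseg[t -> _]; rewrite !pairingN !pairingZ uCE !mulr0.
  have PN X : P X -> -2 <= pairing (- uC.1, - uC.2) X.
    by move=> PX; rewrite pairingN; have := uL_ge PX; have := uR_ge PX; rewrite uRE'; lra.
  have := mutP Fal fN PN QY.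
  by rewrite [X in _ * X]pairingN pairingZ uCE mulr0 oppr0 mulr0 subr0.
have QA := Q_left (or_introl erefl); have QCl := Q_left (or_intror erefl).
have QB := Q_right (or_introl erefl); have QCr := Q_right (or_intror erefl).
have yseg : 0 <= (2 - y) / 3 by lra.
have yseg1 : (2 - y) / 3 <= 1 by lra.
case: spec => [[xE x'E y'E]|[xE /andP[y3 y4] x'E y'E]|
               [yE /andP[x1 x2] x'E y'E]|[yE /andP[x1 x2] x'E y'E]].
- apply: (@boundary_support Q _ (-1) Z E _ supL); last 2 first.
  + by rewrite pairingB x'E y'E; lra.
  + by rewrite pairingB uLE uCE mul0r subr0.
  apply: (Q_segment QA QCl yseg yseg1); rewrite ?shear_uL ?shear_uC.
    by rewrite uLa uLc uCa uCc x'E -/p; lra.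
  by rewrite uCa uCc y'E; lra.
- apply: (@boundary_support Q _ (-1) Z (-1 *: E) _ supR); last 2 first.
  + by rewrite pairingB uRE' x'E y'E; lra.
  + by rewrite pairingB !pairingZ uRE uCE !mulr0 mul0r subr0 mulN1r opprK.
  apply: (Q_segment QB QCr yseg yseg1); rewrite ?shear_uL ?shear_uC.
    by rewrite uLb uLc uCb uCc x'E -/q; lra.
  by rewrite uCb uCc y'E; lra.
- apply: (@boundary_support Q _ (-1) Z C _ supC) => //; last by rewrite uCc.
  have m0 : 0 < 3 - (q - p) by lra.
  have t0 : 0 <= (x + 1) / (3 - (q - p)) by apply: divr_ge0; lra.
  have t1 : (x + 1) / (3 - (q - p)) <= 1 by rewrite ler_pdivrMr//; lra.
  apply: (Q_segment QB QA t0 t1); rewrite ?shear_uL ?shear_uC.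
    rewrite uLa uLb uCa uCb x'E -/p -/q.
    have : (x + 1) / (3 - (q - p)) * (3 - (q - p)) = x + 1 by rewrite divfK// gt_eqF.
    by lra.
  by rewrite uCa uCb y'E; lra.
- apply: (@boundary_support Q _ (-2) Z A _ supN); last 2 first.
  + by rewrite pairingN y'E.
  + by rewrite pairingN uCa; lra.
  have m0 : 0 < 2 * (q - p) by lra.
  have t0 : 0 <= (x - 2 + (q - p)) / (2 * (q - p)) by apply: divr_ge0; lra.
  have t1 : (x - 2 + (q - p)) / (2 * (q - p)) <= 1 by rewrite ler_pdivrMr//; lra.
  apply: (Q_segment QCr QCl t0 t1); rewrite ?shear_uL ?shear_uC.
    rewrite uLc uCc x'E -/p -/q.
    have : (x - 2 + (q - p)) / (2 * (q - p)) * (2 * (q - p)) = x - 2 + (q - p).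
      by rewrite divfK// gt_eqF.
    by lra.
  by rewrite uCc y'E; lra.
Qed.

(** The images lie on the edges of the mutation, and their coordinates tell which
    boundary point they come from. *)
Lemma wide_mutation : (boundary_lattice_pts P #<= boundary_lattice_pts Q)%card.
Proof.
apply: (card_le_inj (g := boundary_map)) => [v /boundary_map_coord|u v /boundary_map_coord su /boundary_map_coord sv uv].
  exact: moved_by_boundary.
rewrite uv in su; have [eL eC] := moved_by_inj p_lt_q q_sub_p_le3 su sv.
by apply: lattice_pt_inj; apply: (line_form_inj cab0 ca0).
Qed.

End Wide.

End TriangleMutation.

Lemma centred_triangle_swap P a b c :
  centred_triangle P a b c -> centred_triangle P b a c.
Proof.
rewrite /centred_triangle; move: (lattice_pt a) (lattice_pt b) (lattice_pt c).
move=> A B C [PE abc ab vP]; split.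
- by rewrite PE (setUC [set A]).
- by rewrite (addrC B).
- by apply: contraNneq ab => ba; rewrite /cross; move: ba; rewrite /cross; lra.
- by rewrite vP (setUC [set A]).
Qed.

Lemma centred_triangle_rot P a b c :
  centred_triangle P a b c -> centred_triangle P b c a.
Proof.
rewrite /centred_triangle; move: (lattice_pt a) (lattice_pt b) (lattice_pt c).
move=> A B C [PE abc ab vP]; split.
- by rewrite PE -setUA setUC.
- by rewrite addrC addrA.
- by rewrite (cross_cyclic abc).
- by rewrite vP -setUA setUC.
Qed.

Section Minimality.
Variables (w : int * int) (P F : set NQ) (Rh : int -> set NQ) (al be : int).
Let E := lattice_pt (direction w).
Hypothesis w_prim : primitive w.
Hypothesis remR : remainders w P F Rh.
Hypothesis Fal : F (al%:~R *: E).
Hypothesis Fbe : F (be%:~R *: E).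
Hypothesis Fseg : forall f, F f -> exists2 t : rat, f = t *: E & al%:~R <= t <= be%:~R.

Lemma direction_neq0 : E != 0.
Proof.
apply/eqP => /matrixP E0; move: w_prim; rewrite /primitive.
have /eqP := E0 0 0; have /eqP := E0 0 1; rewrite !mxE /= !intr_eq0 oppr_eq0.
by move=> /eqP -> /eqP ->.
Qed.

Lemma bottom_edge_mutation a b c : centred_triangle P a b c ->
  wint w b = wint w a -> wint w a < 0 -> al < be ->
  (boundary_lattice_pts P #<= boundary_lattice_pts (mut w P F Rh))%card.
Proof.
move=> T wba wa0 ab.
have [m bE] : exists m, b = a + m *: direction w.
  have [|m mE] := @height0_multiple w w_prim (b - a).
    apply/eqP; rewrite -(intr_eq0 rat) -weval_lattice lattice_ptD lattice_ptN.
    by rewrite -scaleN1r wevalD wevalZ !weval_lattice wba mulN1r subrr.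
  by exists m; rewrite -mE addrC subrK.
have [m0|m0|m0] := ltgtP m 0.
- have [PE abc0 ab0 vP] := centred_triangle_swap T.
  apply: (wide_mutation PE abc0 ab0 vP remR Fal Fbe Fseg (l := - m)) => //.
  + by rewrite wba.
  + by rewrite bE scaleNr addrK.
  + by rewrite oppr_gt0.
- have [PE abc0 ab0 vP] := T.
  exact: (wide_mutation PE abc0 ab0 vP remR Fal Fbe Fseg wba wa0 bE m0 ab).
- have [_ _ /eqP[]] := T.
  by rewrite bE m0 scale0r addr0 /cross; ring.
Qed.

Lemma unique_lowest_point a b c x :
  (forall v, v = b \/ v = c -> wint w a < wint w v) ->
  conv_hull [set lattice_pt a; lattice_pt b; lattice_pt c] x ->
  weval w x = (wint w a)%:~R -> x = lattice_pt a.
Proof.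
move=> low Px wx.
suff [//|] : x = lattice_pt a \/ (wint w a)%:~R < weval w x by rewrite wx ltxx.
move: x Px {wx}; apply: conv_hull_min => [x y t hx hy t0 t1|x [[|]|] ->].
- have [t_eq0|tn0] := eqVneq t 0.
    by rewrite t_eq0 scale0r add0r subr0 scale1r.
  have [t_eq1|tn1] := eqVneq t 1.
    by rewrite t_eq1 subrr scale0r addr0 scale1r.
  have tp : 0 < t by rewrite lt_neqAle eq_sym tn0.
  have tl : t < 1 by rewrite lt_neqAle tn1.
  case: hx hy => [->|hx] [->|hy].
  + by left; rewrite -scalerDl addrC subrK scale1r.
  + by right; rewrite wevalD !wevalZ weval_lattice; nra.
  + by right; rewrite wevalD !wevalZ weval_lattice; nra.
  + by right; rewrite wevalD !wevalZ; nra.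
- by left.
- by right; rewrite weval_lattice ltr_int; apply: low; left.
- by right; rewrite weval_lattice ltr_int; apply: low; right.
Qed.

(** If only [a] had the lowest height, the two translates of the remainder there
    by the ends of the factor would both be [a], and the factor a point. *)
Lemma lowest_vertex_mutation a b c : centred_triangle P a b c -> al < be ->
  wint w a <= wint w b -> wint w a <= wint w c ->
  (boundary_lattice_pts P #<= boundary_lattice_pts (mut w P F Rh))%card.
Proof.
move=> T albe wab wac; have [PE abc0 ab0 vP] := T.
have sum0 : wint w a + wint w b + wint w c = 0.
  have : weval w (lattice_pt a + lattice_pt b + lattice_pt c) = 0.
    by rewrite abc0 -(scale0r (0 : NQ)) wevalZ mul0r.
  by rewrite !wevalD !weval_lattice -!intrD => /eqP; rewrite intr_eq0 => /eqP.
have wa0 : wint w a < 0.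
  rewrite ltNge; apply/negP => wa_ge0.
  have wa_eq0 : wint w a = 0 by lia.
  have wb_eq0 : wint w b = 0 by lia.
  have [m aE] := height0_multiple w_prim wa_eq0.
  have [n bE] := height0_multiple w_prim wb_eq0.
  by case/eqP: ab0; rewrite aE bE !lattice_ptZ /cross !mxE; ring.
have [wba|wba] := eqVneq (wint w b) (wint w a).
  exact: bottom_edge_mutation T wba wa0 albe.
have [wca|wca] := eqVneq (wint w c) (wint w a).
  exact: bottom_edge_mutation (centred_triangle_rot (centred_triangle_swap T)) wca wa0 albe.
have low v : v = b \/ v = c -> wint w a < wint w v.
  by case=> ->; rewrite lt_neqAle eq_sym ?wba ?wca.
have Pa : P (lattice_pt a) by apply: (triangle_vertex PE); left.
have mh := hmin_le w PE Pa.
have va : vertices P (lattice_pt a) by rewrite vP; left; left.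
have la : level w (wint w a) (lattice_pt a) by exists a => //; exact: weval_lattice.
have [_ vsub _] := remR mh wa0.
have [r rR _] := vsub _ (conj va la).
have point g : F g -> r - (wint w a)%:~R *: g = lattice_pt a.
  move=> Fg; have := remR; rewrite {1}PE => remR'.
  have mh' : hmin w (conv_hull [set lattice_pt a; lattice_pt b; lattice_pt c]) <= wint w a.
    by rewrite -PE.
  have sx := remainder_shift remR' mh' wa0 rR Fg.
  by apply: (unique_lowest_point low (slice_sub sx)); exact: slice_weval sx.
have := etrans (point _ Fal) (esym (point _ Fbe)).
move=> /addrI /oppr_inj /(scalerI _).
rewrite intr_eq0 (ltr0_neq0 wa0) => /(_ isT) /eqP.
rewrite -subr_eq0 -scalerBl scaler_eq0 (negbTE direction_neq0) orbF subr_eq0 eqr_int.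
by rewrite (lt_eqF albe).
Qed.

Lemma mutation_boundary a b c : centred_triangle P a b c ->
  (boundary_lattice_pts P #<= boundary_lattice_pts (mut w P F Rh))%card.
Proof.
move=> T; have [PE abc0 ab0 vP] := T.
have [albe|beal|albe] := ltgtP al be; last 1 first.
- exact: (translate_mutation PE abc0 ab0 vP remR Fal Fseg albe).
- have [m [mE ma mb mc]] := min_of_three (wint w) a b c.
  case: mE ma mb mc => [->|[->|->]] ma mb mc.
  + exact: lowest_vertex_mutation T albe mb mc.
  + exact: lowest_vertex_mutation (centred_triangle_rot T) albe mc ma.
  + exact: lowest_vertex_mutation (centred_triangle_rot (centred_triangle_rot T)) albe ma mb.
- have [t _ /andP[t1 t2]] := Fseg Fal.
  by have := le_trans t1 t2; rewrite ler_int leNgt beal.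
Qed.
End Minimality.

Theorem lemma4p3 (R : realType) (P : set NQ) :
  kahler_einstein R P -> triangle P -> minimal P.
Proof.
move=> KE triP; split; first by case: KE.
have [a [b [c T]]] := kahler_einstein_triangle KE triP.
move=> w F Q pw [[lF wF _] [Rh remR ->]].
have [al [be [Fal Fbe Fseg]]] := factor_segment pw lF wF.
exact: (mutation_boundary pw remR Fal Fbe Fseg T).
Qed.
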